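(* (i) The nontrivial torsion elements of $SL(2,\mathbb{Z})$ have order $6$, $4$, $3$ or $2$. There is one conjugacy class of elements of order $2$, and there are two conjugacy classes for each of the other orders; representatives are $$M=\begin{pmatrix}1&-1\\1&0\end{pmatrix},\ M^{-1}=\begin{pmatrix}0&1\\-1&1\end{pmatrix}\ (\text{order }6);\quad S=\begin{pmatrix}0&-1\\1&0\end{pmatrix},\ S^{-1}\ (\text{order }4);$$ $$M^{2}=\begin{pmatrix}0&-1\\1&-1\end{pmatrix},\ M^{-2}=\begin{pmatrix}-1&1\\-1&0\end{pmatrix}\ (\text{order }3);\quad -I\ (\text{order }2).$$ (ii) Any lift to $\mathrm{Aut}^+(F_2)$, having the same order, of an element of $SL(2,\mathbb{Z})$ of order $2$, $4$ or $3$ is conjugate in $\mathrm{Aut}^+(F_2)$, respectively, to $\sigma$; to $\iota$ or $\iota^{-1}$; to $\zeta$ or $\zeta^{-1}$. There is no element of order $6$ in $\mathrm{Aut}^+(F_2)$.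
   Context: $F_2=\langle u,v\rangle$ is the free group on two generators; $\rho:\mathrm{Aut}(F_2)\to GL(2,\mathbb{Z})$ is induced by abelianization (images of the generators as columns) and $\mathrm{Aut}^+(F_2)=\rho^{-1}(SL(2,\mathbb{Z}))$. A lift of $g\in SL(2,\mathbb{Z})$ is an element $\gamma\in\mathrm{Aut}^+(F_2)$ with $\rho(\gamma)=g$. The automorphisms $\sigma,\iota,\zeta$ are defined by $$\sigma:(u,v)\mapsto(u^{-1},v^{-1}),\quad \iota:(u,v)\mapsto(v,u^{-1}),\quad \zeta:(u,v)\mapsto(v,v^{-1}u^{-1}),$$ of orders $2$, $4$, $3$ respectively. *)

(* Defs.v *)
From HB Require Import structures.
From mathcomp Require Import all_boot all_order all_algebra.
From mathcomp Require Import boolp.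

Set Implicit Arguments.
Unset Strict Implicit.
Unset Printing Implicit Defensive.

Import Order.TTheory GRing.Theory Num.Theory.
Local Open Scope group_scope.

Definition has_order (G : groupType) (x : G) (n : nat) : Prop :=
  [/\ (0 < n)%N, x ^+ n = 1 & forall m, (0 < m < n)%N -> x ^+ m <> 1].

Definition torsion (G : groupType) (x : G) : Prop :=
  exists2 n, (0 < n)%N & x ^+ n = 1.

Definition conjugate (G : groupType) (x y : G) : Prop := exists h : G, y = x ^ h.

(* s lists each conjugacy class of elements of order n exactly once; in
   particular there are size s such classes. *)
Definition order_class_reps (G : groupType) (n : nat) (s : seq G) : Prop :=
  [/\ {in s, forall x, has_order x n},
      forall x, has_order x n -> exists2 y, y \in s & conjugate x y,
      {in s &, forall x y, conjugate x y -> x = y}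
    & uniq s].

Section FreeGroup.

Variable X : choiceType.

(* (x, false) stands for the generator x and (x, true) for its inverse. *)
Definition letter := (X * bool)%type.
Definition letter_inv (a : letter) : letter := (a.1, ~~ a.2).
Definition reduced (w : seq letter) : bool :=
  sorted (fun a b => b != letter_inv a) w.

Record free_group := FreeGroup {word :> seq letter; _ : reduced word}.

HB.instance Definition _ := [isSub for word].
HB.instance Definition _ := [Choice of free_group by <:].

Definition push (a : letter) (w : seq letter) : seq letter :=
  if w is b :: w' then if b == letter_inv a then w' else a :: w else [:: a].

Lemma letter_invK : involutive letter_inv.
Proof. by case=> x b; rewrite /letter_inv /= negbK. Qed.

Lemma push_reduced a w : reduced w -> reduced (push a w).
Proof.
case: w => [|b w] //=; case: ifP => [_|/negbT nab] /=.
  exact: path_sorted.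
by rewrite nab.
Qed.

Lemma foldr_push_reduced w1 w2 : reduced w2 -> reduced (foldr push w2 w1).
Proof. by move=> rw2; elim: w1 => //= a w1 IH; apply: push_reduced. Qed.

Lemma foldr_push_nil w : reduced w -> foldr push [::] w = w.
Proof.
elim: w => //= a w IH pw; rewrite IH; last exact: path_sorted pw.
by case: w pw {IH} => //= b w /andP[/negbTE -> _].
Qed.

Lemma pushK a w : reduced w -> push (letter_inv a) (push a w) = w.
Proof.
case: w => [|b w] /= => [_|]; first by rewrite letter_invK eqxx.
case: eqP => [-> |_] pw /=; last by rewrite letter_invK eqxx.
by case: w pw => //= c w /andP[/negbTE ->].
Qed.

Lemma pushKV a w : reduced w -> push a (push (letter_inv a) w) = w.
Proof. by move=> rw; rewrite -{1}(letter_invK a) pushK. Qed.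

Lemma foldr_push_push a w1 w2 :
  reduced w1 -> reduced w2 ->
  foldr push w2 (push a w1) = push a (foldr push w2 w1).
Proof.
case: w1 => //= b w1 pw rw2; case: eqP => [-> |//].
by rewrite pushKV // foldr_push_reduced.
Qed.

Fact fg_one_subproof : reduced [::]. Proof. by []. Qed.
Definition fg_one := FreeGroup fg_one_subproof.

Fact fg_mul_subproof (x y : free_group) : reduced (foldr push (word y) (word x)).
Proof. by apply: foldr_push_reduced; case: y. Qed.
Definition fg_mul (x y : free_group) := FreeGroup (fg_mul_subproof x y).

Fact fg_inv_subproof (x : free_group) : reduced (rev (map letter_inv (word x))).
Proof.
case: x => w /=; rewrite /reduced rev_sorted; case: w => //= a w.
rewrite path_map; apply: sub_path => b c /= h; apply: contraNN h => /eqP.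
by rewrite letter_invK => ->.
Qed.
Definition fg_inv (x : free_group) := FreeGroup (fg_inv_subproof x).

Fact fg_mulA : associative fg_mul.
Proof.
move=> [x rx] [y ry] [z rz]; apply: val_inj => /=.
elim: x {rx} => //= a x IH.
by rewrite IH foldr_push_push // foldr_push_reduced.
Qed.

Fact fg_mul1 : left_id fg_one fg_mul.
Proof. by move=> x; apply: val_inj. Qed.

Fact fg_mulr1 : right_id fg_one fg_mul.
Proof. by case=> w rw; apply: val_inj; rewrite /= foldr_push_nil. Qed.

Fact fg_mulV : left_inverse fg_one fg_inv fg_mul.
Proof.
suff cancel w z : reduced z ->
    foldr push (foldr push z w) (rev (map letter_inv w)) = z.
  case=> w rw; apply: val_inj; rewrite /= -[X in foldr _ X _]foldr_push_nil //.
  exact: cancel.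
elim: w => [|a w IH] // rz; rewrite /= rev_cons foldr_rcons pushK ?IH //.
exact: foldr_push_reduced.
Qed.

Fact fg_mulrV : right_inverse fg_one fg_inv fg_mul.
Proof.
move=> x; have e : fg_inv (fg_inv x) = x.
  apply: val_inj; rewrite /= map_rev revK -map_comp.
  by rewrite (eq_map letter_invK) map_id.
by rewrite -{1}e fg_mulV.
Qed.

HB.instance Definition _ :=
  isGroup.Build free_group fg_mulA fg_mul1 fg_mulr1 fg_mulV fg_mulrV.

Fact fg_gen_subproof x : reduced [:: (x, false)]. Proof. by []. Qed.
Definition fg_gen (x : X) : free_group := FreeGroup (fg_gen_subproof x).

(* The morphism extending f : X -> G. *)
Definition fg_lift (G : groupType) (f : X -> G) (w : free_group) : G :=
  foldr (fun a g => (if a.2 then (f a.1)^-1 else f a.1) * g) 1 (word w).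

Lemma fg_liftM (G : groupType) (f : X -> G) : {morph fg_lift f : x y / x * y}.
Proof.
move=> [x rx] [y ry]; rewrite /fg_lift /=.
set h := foldr _ _.
have hpush a w : h (push a w) = (if a.2 then (f a.1)^-1 else f a.1) * h w.
  case: w => [|b w] //=; case: eqP => [-> |//] /=.
  by rewrite mulgA; case: (a.2) => /=; rewrite ?mulVg ?mulgV mul1g.
elim: x {rx} => /= [|a x IH]; first by rewrite mul1g.
by rewrite hpush IH mulgA.
Qed.

Lemma fg_lift_gen (G : groupType) (f : X -> G) x : fg_lift f (fg_gen x) = f x.
Proof. by rewrite /fg_lift /= mulg1. Qed.

Lemma fg_ind (P : free_group -> Prop) :
  P 1 -> (forall x w, P w -> P (fg_gen x * w)) ->
  (forall x w, P w -> P ((fg_gen x)^-1 * w)) -> forall w, P w.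
Proof.
move=> P1 Pg PV [w rw]; elim: w rw => [|[x b] w IH] rw.
  by rewrite (_ : FreeGroup _ = 1) //; apply: val_inj.
have rw' : reduced w by apply: path_sorted rw.
rewrite (_ : FreeGroup rw =
  (if b then (fg_gen x)^-1 else fg_gen x) * FreeGroup rw').
  by case: (b); [apply: PV | apply: Pg].
by apply: val_inj; case: b rw => /=; case: (w) => //= c w' /andP[/negbTE ->].
Qed.

Lemma fg_ext (G : groupType) (f g : free_group -> G) :
  {morph f : x y / x * y} -> {morph g : x y / x * y} ->
  (forall x, f (fg_gen x) = g (fg_gen x)) -> f =1 g.
Proof.
have m1 h : {morph h : x y / x * y :> free_group >-> x * y :> G} -> h 1 = 1.
  by move=> hM; apply: (@mulgI _ (h 1)); rewrite -hM !mulg1.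
have mV h x : {morph h : x y / x * y :> free_group >-> x * y :> G} ->
    h x^-1 = (h x)^-1.
  by move=> hM; apply: (@mulgI _ (h x)); rewrite -hM !mulgV m1.
move=> fM gM e; elim/fg_ind => [|x w IH|x w IH]; first by rewrite !m1.
  by rewrite fM gM e IH.
by rewrite fM gM !mV // e IH.
Qed.

End FreeGroup.

Section Automorphisms.

Variable G : groupType.

Record autom := Autom {
  autom_fun :> G -> G;
  autom_inv : G -> G;
  autom_funK : cancel autom_fun autom_inv;
  autom_invK : cancel autom_inv autom_fun;
  automM : {morph autom_fun : x y / x * y} }.

Lemma autom_eq (f g : autom) : f =1 g -> f = g.
Proof.
case: f g => [f f' fK f'K fM] [g g' gK g'K gM] /= /funext e; subst g.
have e : f' = g' by apply: funext => x; rewrite -{1}(g'K x) fK.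
by subst g'; congr Autom; apply: Prop_irrelevance.
Qed.

HB.instance Definition _ := gen_eqMixin autom.
HB.instance Definition _ := gen_choiceMixin autom.

Definition autom_id : autom :=
  @Autom id id (fun=> erefl) (fun=> erefl) (fun _ _ => erefl).

Fact autom_comp_subproof (f g : autom) : {morph f \o g : x y / x * y}.
Proof. by move=> x y; rewrite /= !automM. Qed.

(* Composition of maps: (f * g) x = f (g x). *)
Definition autom_comp (f g : autom) : autom :=
  @Autom (f \o g) (autom_inv g \o autom_inv f)
    (can_comp (@autom_funK f) (@autom_funK g))
    (can_comp (@autom_invK g) (@autom_invK f))
    (@autom_comp_subproof f g).

Fact autom_opp_subproof (f : autom) : {morph autom_inv f : x y / x * y}.
Proof.
by move=> x y; apply: (can_inj (@autom_funK f)); rewrite automM !autom_invK.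
Qed.

Definition autom_opp (f : autom) : autom :=
  @Autom (autom_inv f) f (@autom_invK f) (@autom_funK f) (@autom_opp_subproof f).

Fact autom_compA : associative autom_comp.
Proof. by move=> f g h; apply: autom_eq. Qed.
Fact autom_comp1 : left_id autom_id autom_comp.
Proof. by move=> f; apply: autom_eq. Qed.
Fact autom_compr1 : right_id autom_id autom_comp.
Proof. by move=> f; apply: autom_eq. Qed.
Fact autom_compV : left_inverse autom_id autom_opp autom_comp.
Proof. by move=> f; apply: autom_eq => x /=; rewrite autom_funK. Qed.
Fact autom_comprV : right_inverse autom_id autom_opp autom_comp.
Proof. by move=> f; apply: autom_eq => x /=; rewrite autom_invK. Qed.

HB.instance Definition _ :=
  isGroup.Build autom autom_compA autom_comp1 autom_compr1
    autom_compV autom_comprV.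

End Automorphisms.

Definition F2 := free_group 'I_2.
HB.instance Definition _ := Group.on F2.

Lemma ord2P (i : 'I_2) : i != ord0 -> i = ord_max.
Proof. by case: i => [[|[|i]] hi] // _; apply: val_inj. Qed.

Definition gen_u : F2 := fg_gen ord0.
Definition gen_v : F2 := fg_gen ord_max.

(* The exponent sums give the isomorphism of the abelianization of F2 with
   Z^2 sending the classes of u and v to the canonical basis. *)
Definition exp_sum (i : 'I_2) (w : F2) : int :=
  (\sum_(a <- word w | a.1 == i) (-1) ^+ a.2)%R.

Lemma exp_sumM i x y : exp_sum i (x * y) = (exp_sum i x + exp_sum i y)%R.
Proof.
case: x y => [x rx] [y ry]; rewrite /exp_sum /=.
have hpush a w : (\sum_(b <- push a w | b.1 == i) (-1) ^+ b.2 =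
    (if a.1 == i then (-1) ^+ a.2 else 0) +
    \sum_(b <- w | b.1 == i) (-1) ^+ b.2 :> int)%R.
  have e0 : (\sum_(b <- a :: w | b.1 == i) (-1) ^+ b.2 =
    (if a.1 == i then (-1) ^+ a.2 else 0) +
    \sum_(b <- w | b.1 == i) (-1) ^+ b.2 :> int)%R.
    by rewrite big_cons; case: ifP => //; rewrite add0r.
  case: w e0 => [|b w] //=; case: (b =P letter_inv a) => [-> _|_ //].
  rewrite big_cons /=; case: ifP => _; last by rewrite add0r.
  by rewrite addrA; case: (a.2); rewrite /= ?(expr0, expr1) ?addNr ?subrr add0r.
elim: x {rx} => /= [|a x IH]; first by rewrite big_nil add0r.
by rewrite hpush IH big_cons; case: ifP => _; rewrite ?addrA // add0r.
Qed.

Lemma exp_sum1 i : exp_sum i 1 = 0%R.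
Proof. by rewrite /exp_sum big_nil. Qed.

Lemma exp_sumV i x : exp_sum i x^-1 = (- exp_sum i x)%R.
Proof.
by apply/eqP; rewrite -addr_eq0 -exp_sumM mulVg exp_sum1.
Qed.

Lemma exp_sum_gen i j : exp_sum i (fg_gen j) = ((j == i)%:R)%R.
Proof. by rewrite /exp_sum big_cons big_nil /=; case: eqP; rewrite ?addr0. Qed.

Definition rho (f : autom F2) : 'M[int]_2 :=
  (\matrix_(i, j) exp_sum i (f (fg_gen j)))%R.

(* rho f is the matrix of the map that f induces on Z^2. *)
Lemma exp_sum_autom (f : autom F2) i w :
  exp_sum i (f w) = (\sum_j rho f i j * exp_sum j w)%R.
Proof.
have f1 : f 1 = 1 by apply: (@mulgI _ (f 1)); rewrite -automM !mulg1.
have fV x : f x^-1 = (f x)^-1.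
  by apply: (@mulgI _ (f x)); rewrite -automM !mulgV f1.
have fgen j : exp_sum i (f (fg_gen j)) =
    (\sum_k rho f i k * exp_sum k (fg_gen j))%R.
  rewrite (bigD1 j) //= big1 ?addr0 => [|k nkj].
    by rewrite exp_sum_gen eqxx mulr1 mxE.
  by rewrite exp_sum_gen eq_sym (negbTE nkj) mulr0.
elim/fg_ind: w => [|j w IH|j w IH].
- by rewrite f1 exp_sum1 big1 // => j _; rewrite exp_sum1 mulr0.
- rewrite automM exp_sumM IH fgen -big_split; apply: eq_bigr => k _ /=.
  by rewrite exp_sumM mulrDr.
- rewrite automM exp_sumM IH fV exp_sumV fgen -sumrN -big_split.
  by apply: eq_bigr => k _ /=; rewrite exp_sumM exp_sumV mulrDr mulrN.
Qed.

Lemma rhoM f g : rho (f * g) = (rho f *m rho g)%R.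
Proof.
apply/matrixP => i j; rewrite !mxE /= exp_sum_autom.
by apply: eq_bigr => k _; rewrite !mxE.
Qed.

Lemma rho1 : rho 1 = 1%:M%R.
Proof. by apply/matrixP => i j; rewrite !mxE exp_sum_gen eq_sym. Qed.

Definition aut_plus_pred : pred (autom F2) := fun f => (\det (rho f) == 1)%R.

Record aut_plus :=
  AutPlus {aut_plus_val :> autom F2; _ : aut_plus_pred aut_plus_val}.

HB.instance Definition _ := [isSub for aut_plus_val].
HB.instance Definition _ := [Choice of aut_plus by <:].

Fact aut_plus_closed : group_closed aut_plus_pred.
Proof.
split=> [|f g]; first by rewrite unfold_in /aut_plus_pred rho1 det1.
rewrite !unfold_in /aut_plus_pred => /eqP df /eqP dg.
have := congr1 determinant (rhoM g g^-1); rewrite mulgV rho1 det1 det_mulmx dg.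
by rewrite mul1r rhoM det_mulmx df mul1r => <-.
Qed.

HB.instance Definition _ :=
  SubChoice_isSubGroup.Build (autom F2) aut_plus_pred aut_plus aut_plus_closed.

Record SL2Z := SL2 {SL2_val :> 'M[int]_2; _ : (\det SL2_val == 1)%R}.

HB.instance Definition _ := [isSub for SL2_val].
HB.instance Definition _ := [Choice of SL2Z by <:].

Lemma SL2_unitmx (g : SL2Z) : SL2_val g \in unitmx.
Proof. by case: g => A /= /eqP dA; rewrite unitmxE dA unitr1. Qed.

Fact SL2_one_subproof : (\det (1%:M : 'M[int]_2) == 1)%R.
Proof. by rewrite det1. Qed.
Fact SL2_mul_subproof (g h : SL2Z) : (\det (SL2_val g *m SL2_val h) == 1)%R.
Proof. by case: g h => A dA [B dB] /=; rewrite det_mulmx (eqP dA) (eqP dB). Qed.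
Fact SL2_inv_subproof (g : SL2Z) : (\det (invmx (SL2_val g)) == 1)%R.
Proof. by case: g => A /eqP dA /=; rewrite det_inv dA invr1. Qed.

Definition SL2_mul (g h : SL2Z) := SL2 (SL2_mul_subproof g h).
Definition SL2_inv (g : SL2Z) := SL2 (SL2_inv_subproof g).

Fact SL2_mulA : associative SL2_mul.
Proof. by move=> f g h; apply: val_inj; rewrite /= mulmxA. Qed.
Fact SL2_mul1 : left_id (SL2 SL2_one_subproof) SL2_mul.
Proof. by move=> g; apply: val_inj; rewrite /= mul1mx. Qed.
Fact SL2_mulr1 : right_id (SL2 SL2_one_subproof) SL2_mul.
Proof. by move=> g; apply: val_inj; rewrite /= mulmx1. Qed.
Fact SL2_mulV : left_inverse (SL2 SL2_one_subproof) SL2_inv SL2_mul.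
Proof. by move=> g; apply: val_inj; rewrite /= mulVmx ?SL2_unitmx. Qed.
Fact SL2_mulrV : right_inverse (SL2 SL2_one_subproof) SL2_inv SL2_mul.
Proof. by move=> g; apply: val_inj; rewrite /= mulmxV ?SL2_unitmx. Qed.

HB.instance Definition _ :=
  isGroup.Build SL2Z SL2_mulA SL2_mul1 SL2_mulr1 SL2_mulV SL2_mulrV.

(* The matrix with rows (a b) and (c d). *)
Definition mx2 (a b c d : int) : 'M[int]_2 :=
  (\matrix_(i, j) if i == 0 then if j == 0 then a else b
                  else if j == 0 then c else d)%R.

Lemma det_mx2 a b c d : (\det (mx2 a b c d) = a * d - b * c)%R.
Proof.
rewrite (expand_det_row _ ord0) !big_ord_recl big_ord0 addr0 /cofactor.
by rewrite !det_mx11 !mxE /= expr0 expr1 mul1r mulN1r mulrN.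
Qed.

Fact SL2_M_subproof : (\det (mx2 1 (-1) 1 0) == 1)%R.
Proof. by rewrite det_mx2. Qed.
Fact SL2_S_subproof : (\det (mx2 0 (-1) 1 0) == 1)%R.
Proof. by rewrite det_mx2. Qed.
Fact SL2_negI_subproof : (\det (- 1%:M : 'M[int]_2) == 1)%R.
Proof. by rewrite -scaleN1r detZ det1. Qed.

Definition SL2_M : SL2Z := SL2 SL2_M_subproof.
Definition SL2_S : SL2Z := SL2 SL2_S_subproof.
Definition SL2_negI : SL2Z := SL2 SL2_negI_subproof.

Definition lift_of (g : SL2Z) (gamma : aut_plus) : Prop :=
  rho gamma = g :> 'M[int]_2.

(* The endomorphism u |-> x, v |-> y. *)
Definition endo2 (x y : F2) : F2 -> F2 :=
  fg_lift (fun i : 'I_2 => if i == ord0 then x else y).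

Lemma endo2M x y : {morph endo2 x y : w z / w * z}.
Proof. exact: fg_liftM. Qed.
Lemma endo2V x y w : endo2 x y w^-1 = (endo2 x y w)^-1.
Proof.
have e1 : endo2 x y 1 = 1 by apply: (@mulgI _ (endo2 x y 1)); rewrite -endo2M !mulg1.
by apply: (@mulgI _ (endo2 x y w)); rewrite -endo2M !mulgV.
Qed.
Lemma endo2u x y : endo2 x y gen_u = x.
Proof. by rewrite /endo2 /gen_u fg_lift_gen. Qed.
Lemma endo2v x y : endo2 x y gen_v = y.
Proof. by rewrite /endo2 /gen_v fg_lift_gen. Qed.

Lemma endo2_cancel x y x' y' :
  endo2 x' y' x = gen_u -> endo2 x' y' y = gen_v ->
  cancel (endo2 x y) (endo2 x' y').
Proof.
move=> ex ey; apply: (@fg_ext _ F2 (endo2 x' y' \o endo2 x y) id) => //.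
  by move=> w z; rewrite /= !endo2M.
move=> i; rewrite /= /endo2 fg_lift_gen.
by case: eqVneq => [->|/ord2P ->]; [exact: ex | exact: ey].
Qed.

Definition endo2E := (endo2M, endo2V, endo2u, endo2v).

Fact sigma_invol : cancel (endo2 gen_u^-1 gen_v^-1) (endo2 gen_u^-1 gen_v^-1).
Proof. by apply: endo2_cancel; by rewrite !endo2E invgK. Qed.

Definition sigma_aut : autom F2 :=
  Autom sigma_invol sigma_invol (@endo2M gen_u^-1 gen_v^-1).

Fact iota_funK : cancel (endo2 gen_v gen_u^-1) (endo2 gen_v^-1 gen_u).
Proof. by apply: endo2_cancel; by rewrite !endo2E ?invgK. Qed.
Fact iota_invK : cancel (endo2 gen_v^-1 gen_u) (endo2 gen_v gen_u^-1).
Proof. by apply: endo2_cancel; by rewrite !endo2E ?invgK. Qed.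

Definition iota_aut : autom F2 :=
  Autom iota_funK iota_invK (@endo2M gen_v gen_u^-1).

Fact zeta_funK :
  cancel (endo2 gen_v (gen_v^-1 * gen_u^-1)) (endo2 (gen_v^-1 * gen_u^-1) gen_u).
Proof. by apply: endo2_cancel; by rewrite !endo2E ?invgM ?invgK ?mulKg. Qed.
Fact zeta_invK :
  cancel (endo2 (gen_v^-1 * gen_u^-1) gen_u) (endo2 gen_v (gen_v^-1 * gen_u^-1)).
Proof. by apply: endo2_cancel; by rewrite !endo2E ?invgM ?invgK ?mulgK. Qed.

Definition zeta_aut : autom F2 :=
  Autom zeta_funK zeta_invK (@endo2M gen_v (gen_v^-1 * gen_u^-1)).

Lemma rho_endo2 (f : autom F2) x y : f =1 endo2 x y ->
  rho f = mx2 (exp_sum ord0 x) (exp_sum ord0 y)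
              (exp_sum ord_max x) (exp_sum ord_max y).
Proof.
move=> e; apply/matrixP => i j; rewrite !mxE e /endo2 fg_lift_gen.
by case: (eqVneq i ord0) => [->|/ord2P ->]; case: (eqVneq j ord0).
Qed.

Definition exp_sumE := (exp_sumM, exp_sumV, exp_sum_gen).

Fact sigma_plus : aut_plus_pred sigma_aut.
Proof.
by rewrite /aut_plus_pred (@rho_endo2 _ gen_u^-1 gen_v^-1) // det_mx2 !exp_sumE.
Qed.
Fact iota_plus : aut_plus_pred iota_aut.
Proof.
by rewrite /aut_plus_pred (@rho_endo2 _ gen_v gen_u^-1) // det_mx2 !exp_sumE.
Qed.
Fact zeta_plus : aut_plus_pred zeta_aut.
Proof.
rewrite /aut_plus_pred (@rho_endo2 _ gen_v (gen_v^-1 * gen_u^-1)) // det_mx2.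
by rewrite !exp_sumE.
Qed.

Definition sigma_F2 : aut_plus := AutPlus sigma_plus.
Definition iota_F2 : aut_plus := AutPlus iota_plus.
Definition zeta_F2 : aut_plus := AutPlus zeta_plus.

(* Main.v *)
Require Import Defs.
From mathcomp Require Import all_boot all_order all_algebra.
From mathcomp Require Import boolp.
From mathcomp Require Import zify ring.

(** Matrices.  If g has determinant 1 and trace t with |t| >= 2, then g^(k+1) is
    p g + q with |p| > |q|, so a torsion element is 1, -1, or has |t| <= 1
    ([torsion_trace]).  In the last case conjugation by elementary unipotents
    shrinks the off-diagonal entries until only M^(+-1), S^(+-1), M^(+-2) are
    left ([elliptic_conj]).  An element and its inverse are not conjugate there,
    because the lower left entry of a conjugate is a value of a definite binary
    quadratic form and so keeps its sign ([lower_left_sign]).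

    Lifts.  Two facts reduce the statement on automorphisms to that on matrices.

    The first is Nielsen's theorem that an automorphism acting trivially on the
    abelianization is inner ([ker_rho]).  Nielsen reduction, carried out with
    Gromov products in the Cayley tree, shows that Aut+(F2) is generated by the
    inner automorphisms, iota and zeta ([aut_plus_ind]).  Modulo inner
    automorphisms these generators satisfy the defining relations of SL(2,Z):
    every element is iota^k p iota^j with p a product of the two positive
    elementary transvections ([positive_form]), and such a p acts by a matrix
    with nonnegative entries, which is a power of S only when p = 1.

    The second is that finite subgroups of groups acting on trees have fixed
    points, in the following form ([twisted_torsion]).  Suppose that t permutes
    the letters of an alphabet, that nonempty reduced words have nontrivial
    values, and that w t and t have finite order.  Either the last letter of w
    cancels against the image under t of its first letter, and conjugating by
    the first letter makes w shorter; or the power of w t is the value of a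
    reduced word, which is absurd.  So w t is conjugate to t, or to a t for a
    letter a that t inverts.  By [ker_rho] a lift as in the statement, or its
    inverse, becomes after a conjugation inn(w) t with t one of sigma, iota and
    zeta.  For sigma and iota the alphabet is that of the generators
    of F2 and their inverses.  For zeta it consists of the three involutions
    a, b, c of the free product of three groups of order 2, whose even words form
    F2 through u = ab and v = bc: zeta permutes them cyclically, and sigma is
    conjugation by b.  The case w t with t = 1 shows that inner automorphisms
    have no torsion.

    Order 6.  If f had order 6, its matrix would too, and up to conjugation and
    inversion f^2 would be zeta and f^3 would be inn(w) sigma.  As these two
    commute, the exponent sums of w would solve 3 p = 1. *)

Set Implicit Arguments.
Unset Strict Implicit.
Unset Printing Implicit Defensive.

Import GRing.Theory Num.Theory.
Local Open Scope group_scope.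

(** * Lengths and Gromov products in a free group *)

Fixpoint lcp (T : eqType) (s t : seq T) : nat :=
  match s, t with
  | a :: s', b :: t' => if a == b then (lcp s' t').+1 else 0%N
  | _, _ => 0%N
  end.

Definition heads_differ (T : eqType) (s t : seq T) : bool :=
  match s, t with a :: _, b :: _ => a != b | _, _ => true end.

Lemma lcpC (T : eqType) (s t : seq T) : lcp s t = lcp t s.
Proof. by elim: s t => [|a s IH] [|b t] //=; rewrite eq_sym IH. Qed.

(** The four-point condition of a tree: three words pairwise branch off each
    other in such a way that the two shortest common prefixes have equal length.
    *)
Lemma lcp_ultra (T : eqType) (s t w : seq T) :
  (minn (lcp s t) (lcp t w) <= lcp s w)%N.
Proof.
elim: s t w => [|a s IH] [|b t] [|c w] //=; rewrite ?min0n ?minn0 //.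
case: (a =P b) => [->|_]; last by rewrite min0n.
by case: (b =P c) => [_|_]; rewrite ?minn0 // minnSS ltnS.
Qed.

Lemma lcp_take (T : eqType) (s : seq T) k :
  (k <= size s)%N -> lcp (take k s) s = k.
Proof. by elim: s k => [|a s IH] [|k] //= ?; rewrite eqxx IH. Qed.

Lemma nth_lcp (T : eqType) (x0 : T) (s t : seq T) i :
  (i < lcp s t)%N -> nth x0 s i = nth x0 t i.
Proof.
elim: s t i => [|a s IH] [|b t] // [|i] /=; case: eqP => // _ ?.
exact: IH.
Qed.

Lemma lcp_split (T : eqType) (s t : seq T) :
  exists p s' t', [/\ s = p ++ s', t = p ++ t', size p = lcp s t
    & heads_differ s' t'].
Proof.
elim: s t => [|a s IH] [|b t] /=.
- by exists [::], [::], [::].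
- by exists [::], [::], (b :: t).
- by exists [::], (a :: s), [::].
case: eqP => [<-|/eqP nab]; last by exists [::], (a :: s), (b :: t).
by have [p [s' [t' [-> -> <- h]]]] := IH t; exists (a :: p), s', t'.
Qed.

Section Length.

Variable X : choiceType.
Implicit Types (x y z : free_group X) (s t : seq (letter X)).

Definition len x : nat := size (word x).
Definition gromov x y : nat := lcp (word x) (word y).

Lemma foldr_push_cat s t : reduced (s ++ t) -> foldr (@push X) t s = s ++ t.
Proof.
elim: s => //= a s IH r; rewrite IH; last exact: path_sorted r.
by case: (s ++ t) r => //= b w /andP[/negbTE -> _].
Qed.

Lemma push_letterK (a : letter X) s : push (letter_inv a) (a :: s) = s.
Proof. by rewrite /= letter_invK eqxx. Qed.

Lemma foldr_push_revK s t :
  foldr (@push X) (s ++ t) (rev (map (@letter_inv X) s)) = t.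
Proof.
by elim: s => // a s IH; rewrite map_cons rev_cons foldr_rcons cat_cons
  push_letterK.
Qed.

Lemma foldr_push_rev_cat s t : reduced s -> heads_differ s t ->
  foldr (@push X) t (rev (map (@letter_inv X) s)) =
  rev (map (@letter_inv X) s) ++ t.
Proof.
elim: s t => // a s IH t rs hd.
rewrite map_cons rev_cons foldr_rcons cat_rcons.
have -> : push (letter_inv a) t = letter_inv a :: t.
  case: t hd => //= b t nab; case: eqP => // e.
  by rewrite e letter_invK eqxx in nab.
apply: IH; first exact: path_sorted rs.
by case: s rs {hd} => //= b s /andP[].
Qed.

(** Exactly the common prefix of x and y cancels in x^-1 y, so that [gromov] is
    the Gromov product in the Cayley tree, based at 1. *)
Lemma len_divl x y : (len (x^-1 * y)%g + (gromov x y).*2 = len x + len y)%N.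
Proof.
have rx : reduced (word x) by case: x.
rewrite /len /gromov.
have -> : word (x^-1 * y) =
  foldr (@push X) (word y) (rev (map (@letter_inv X) (word x))) by [].
have [p [s [t [ex ey <- hd]]]] := lcp_split (word x) (word y).
have rs : reduced s.
  by move: rx; rewrite ex => /cat_sorted2[].
rewrite ex ey map_cat rev_cat foldr_cat foldr_push_revK foldr_push_rev_cat //.
by rewrite !size_cat size_rev size_map -addnn addnACA (addnC (size s)) (addnC (size t)).
Qed.

Lemma len1 : len 1 = 0%N. Proof. by []. Qed.

Lemma len_eq0 x : len x = 0%N -> x = 1.
Proof. by move=> /size0nil h; apply: val_inj. Qed.

Lemma lenV x : len x^-1 = len x.
Proof. by have := len_divl x 1; rewrite mulg1 /gromov lcpC len1 /=; lia. Qed.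

Lemma gromovC x y : gromov x y = gromov y x.
Proof. exact: lcpC. Qed.

Lemma gromov_ultra x y z : (minn (gromov x y) (gromov y z) <= gromov x z)%N.
Proof. exact: lcp_ultra. Qed.

Lemma exists_prefix x k : (k <= len x)%N ->
  exists2 q, len q = k & gromov q x = k.
Proof.
case: x => w rw; rewrite /len /= => lek.
by exists (FreeGroup (take_sorted k rw)); rewrite /gromov /len /= ?lcp_take ?size_takel.
Qed.

Lemma letter_inv_neq (a : letter X) : letter_inv a != a.
Proof. by case: a => i b; apply/eqP => -[]; case: b. Qed.

(** If x and x^-1 shared half of their letters, then the middle letter of x
    would be its own inverse (odd length), or the two middle letters of x would
    cancel (even length). *)
Lemma gromovV_lt x : x <> 1 -> ((gromov x x^-1%g).*2 < len x)%N.
Proof.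
case: x => [[|a0 w] rw] nx; first by case: nx; apply: val_inj.
set x := FreeGroup rw; set s := a0 :: w.
rewrite ltnNge; apply/negP => h.
have nthV i : (i < size s)%N ->
    nth a0 (word x^-1) i = letter_inv (nth a0 s (size s - i.+1)).
  move=> lti; have -> : word x^-1 = rev (map (@letter_inv X) s) by [].
  rewrite nth_rev ?size_map // (nth_map a0) //.
  by rewrite ltn_subrL.
have lt0 : (0 < len x)%N by [].
have sl : size s = len x by [].
have lti : ((len x).-1./2 < size s)%N by rewrite sl; lia.
have lg : ((len x).-1./2 < gromov x x^-1%g)%N by lia.
have := nth_lcp a0 (s := s) (t := word x^-1) (i := (len x).-1./2).
rewrite nthV // => /(_ lg).
case: (boolP (odd (len x))) => od.
  have -> : (size s - (len x).-1./2.+1 = (len x).-1./2)%N.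
    by rewrite sl; lia.
  by move/esym/eqP; rewrite (negbTE (letter_inv_neq _)).
have lti1 : ((len x).-1./2.+1 < size s)%N by rewrite sl; lia.
have -> : (size s - (len x).-1./2.+1 = (len x).-1./2.+1)%N.
  by rewrite sl; lia.
move=> e; have := rw; rewrite /reduced => /(sortedP a0)/(_ _ lti1).
by rewrite e letter_invK eqxx.
Qed.

End Length.

Section Cancellation.
Variable X : choiceType.
Implicit Types (x y z q r : free_group X) (s t : seq (letter X)).

(** The first half of y is q and its second half is r^-1. *)
Lemma half_prefixes y q r k : len y = k.*2 -> len q = k -> len r = k ->
  gromov q y = k -> gromov r y^-1 = k -> q^-1 * y * r = 1.
Proof.
move=> ly lq lr gq gr; apply: len_eq0.
have h1 := len_divl q y.
have e0 : (y^-1 * q)^-1 = q^-1 * y by rewrite invgM invgK.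
have h2 := len_divl (y^-1 * q) r; rewrite e0 in h2.
have h3 := len_divl (y^-1 * q) y^-1; rewrite e0 mulgK !lenV in h3.
have h4 := lenV (y^-1 * q); rewrite e0 in h4.
have := gromov_ultra (y^-1 * q) y^-1 r; rewrite (gromovC _ r) gr.
lia.
Qed.

(** The tie in Nielsen reduction: half of y cancels against x at both ends of y,
    which by itself makes no product shorter. With y = q r^-1 and x = q x' r^-1,
    conjugation by q turns x y^-1 and y into x' and r^-1 q, which are shorter in
    total. *)
Lemma half_cancel x y : y <> 1 ->
  ((gromov x y).*2 = len y)%N -> ((gromov x^-1%g y^-1%g).*2 = len y)%N ->
  (len y <= len x)%N ->
  exists q, (len (q^-1 * (x * y^-1) * q)%g + len (q^-1 * y * q)%g < len x + len y)%N.
Proof.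
move=> ny g1 g2 lyx; set k := gromov x y in g1 *.
have [q lq gq] := @exists_prefix _ y k ltac:(lia).
have [r lr gr] := @exists_prefix _ y^-1 k ltac:(rewrite lenV; lia).
have e := half_prefixes (y := y) (q := q) (r := r) (k := k) ltac:(lia) lq lr gq gr.
have ey : q^-1 * y = r^-1 by apply: (@mulIg _ r); rewrite e mulVg.
have ly : len y <> 0%N by move/len_eq0.
exists q.
have -> : q^-1 * (x * y^-1) * q = q^-1 * x * r.
  by rewrite -(invgK r) -ey invgM invgK !mulgA.
rewrite ey.
have gqx : (k <= gromov q x)%N.
  by have := gromov_ultra q y x; rewrite gq (gromovC y) minnn.
have grx : (k <= gromov x^-1 r)%N.
  by have := gromov_ultra x^-1 y^-1 r; rewrite (gromovC _ r) gr; lia.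
have h0 := len_divl r q.
have h1 := len_divl q x.
have e0 : (x^-1 * q)^-1 = q^-1 * x by rewrite invgM invgK.
have h2 := len_divl (x^-1 * q) r; rewrite e0 in h2.
have h3 := len_divl (x^-1 * q) x^-1; rewrite e0 mulgK !lenV in h3.
have h4 := lenV (x^-1 * q); rewrite e0 in h4.
have := gromov_ultra (x^-1 * q) x^-1 r.
lia.
Qed.


Definition letter_elt (a : letter X) : free_group X :=
  if a.2 then (fg_gen a.1)^-1 else fg_gen a.1.

Lemma letter_eltV a : letter_elt (letter_inv a) = (letter_elt a)^-1.
Proof. by case: a => i [] //=; rewrite /letter_elt /= invgK. Qed.

Lemma word_letter a : word (letter_elt a) = [:: a].
Proof. by case: a => i []. Qed.

Lemma len_letter a : len (letter_elt a) = 1%N. Proof. by rewrite /len word_letter. Qed.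

Lemma word_letterM a x : word (letter_elt a * x) = push a (word x).
Proof.
have -> : word (letter_elt a * x) = foldr (@push X) (word x) (word (letter_elt a)) by [].
by rewrite word_letter.
Qed.

Lemma len1P x : len x = 1%N -> exists a, x = letter_elt a.
Proof.
case: x => -[|a [|b w]] rw // _; exists a; apply: val_inj.
by rewrite [RHS]word_letter.
Qed.

Lemma letter_ind (P : free_group X -> Prop) : P 1 ->
  (forall a w, reduced (a :: word w) -> P w -> P (letter_elt a * w)) -> forall w, P w.
Proof.
move=> P1 PS [w rw]; elim: w rw => [|a w IH] rw.
  by rewrite (_ : FreeGroup _ = 1) //; apply: val_inj.
have rw' : reduced w by apply: path_sorted rw.
rewrite (_ : FreeGroup rw = letter_elt a * FreeGroup rw'); first exact: PS.
apply: val_inj; rewrite [RHS]word_letterM /=.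
by case: (w) rw => //= c w' /andP[/negbTE ->].
Qed.

(** If x is nontrivial, let c be a generator, or its inverse, other than the
    first letter of x and its inverse; its sign can be chosen so that x c is
    reduced. Then c x and x c are both reduced and begin with different letters.
    *)
Lemma center_trivial x : (exists i j : X, i != j) ->
  (forall i, x * fg_gen i = fg_gen i * x) -> x = 1.
Proof.
move=> [i [j nij]] cx.
case: x cx => -[|a w] rw cx; first exact: val_inj.
set x := FreeGroup rw in cx *.
have [k nk] : exists k, k != a.1.
  by have [e|ni] := eqVneq i a.1; [exists j; rewrite -e eq_sym | exists i].
have cxl c : x * letter_elt c = letter_elt c * x.
  case: c => l [] /=; last exact: cx.
  by apply: (@mulgI _ (fg_gen l)); rewrite mulgA mulVKg -cx mulgK.
(* The sign of the last letter of x rules out a cancellation in x c. *)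
pose c := (k, (last a w).2) : letter X.
have c1 : letter_inv a != c by apply: contra nk => /eqP e; rewrite -[k]/(c.1) -e.
have c2 : letter_inv (last a w) != c.
  by apply/eqP => -[_]; case: ((last a w).2).
have ex : word (x * letter_elt c) = rcons (a :: w) c.
  have -> : word (x * letter_elt c) = foldr (@push X) (word (letter_elt c)) (a :: w) by [].
  rewrite word_letter foldr_push_cat cats1 // /reduced /= rcons_path.
  by apply/andP; split; [exact: rw | rewrite eq_sym].
have := congr1 (@word X) (cxl c); rewrite ex word_letterM /=.
case: eqP => [e|_]; first by rewrite e letter_invK eqxx in c1.
by case=> e _; rewrite e eqxx in nk.
Qed.
End Cancellation.

(** * Elementary computations in the automorphism group *)

#[global] Arguments autom_fun : simpl never.

Section AutPlus.
Implicit Types (f g h : aut_plus) (w x y z : F2).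

Lemma aut_compE f g x : (f * g) x = f (g x). Proof. by []. Qed.
Lemma aut_1E x : (1 : aut_plus) x = x. Proof. by []. Qed.
Lemma apVK f x : f^-1 (f x) = x.
Proof. by rewrite -aut_compE mulVg. Qed.
Lemma apKV f x : f (f^-1 x) = x.
Proof. by rewrite -aut_compE mulgV. Qed.
Lemma ap_mul f x y : f (x * y) = f x * f y. Proof. exact: automM. Qed.
Lemma ap1 f : f 1 = 1.
Proof. by apply: (@mulgI _ (f 1)); rewrite -ap_mul !mulg1. Qed.
Lemma apV f x : f x^-1 = (f x)^-1.
Proof. by apply: (@mulgI _ (f x)); rewrite -ap_mul !mulgV ap1. Qed.
Lemma ap_inj f : injective f.
Proof. exact: can_inj (apVK f). Qed.

Lemma aut_ext f g : f gen_u = g gen_u -> f gen_v = g gen_v -> f = g.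
Proof.
move=> eu ev; apply/val_inj/autom_eq.
apply: fg_ext => [||i]; try exact: automM.
by have [->|/ord2P ->] := eqVneq i ord0; [exact: eu | exact: ev].
Qed.

Lemma inn_funK w : cancel (fun z => w * z * w^-1) (fun z => w^-1 * z * w).
Proof. by move=> z; rewrite !mulgA mulVg mul1g mulgVK. Qed.
Lemma inn_invK w : cancel (fun z => w^-1 * z * w) (fun z => w * z * w^-1).
Proof. by move=> z; rewrite !mulgA mulgV mul1g mulgK. Qed.
Lemma inn_mul w : {morph (fun z : F2 => w * z * w^-1) : x y / x * y}.
Proof. by move=> x y; rewrite !mulgA mulgVK. Qed.

Definition inn_aut w : autom F2 :=
  Autom (inn_funK w) (inn_invK w) (@inn_mul w).

Lemma rho_inn w : rho (inn_aut w) = 1%:M%R.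
Proof.
apply/matrixP => i j; rewrite !mxE /= !exp_sumM exp_sumV exp_sum_gen eq_sym.
by rewrite GRing.addrAC GRing.subrr GRing.add0r.
Qed.

Fact inn_plus w : aut_plus_pred (inn_aut w).
Proof. by rewrite /aut_plus_pred rho_inn det1. Qed.

Definition inn w : aut_plus := AutPlus (inn_plus w).

Lemma innE w x : inn w x = w * x * w^-1. Proof. by []. Qed.

Lemma innM w x : inn (w * x) = inn w * inn x.
Proof. by apply: aut_ext; rewrite aut_compE !innE invgM !mulgA. Qed.
Lemma inn1 : inn 1 = 1.
Proof. by apply: aut_ext; rewrite innE invg1 mulg1 mul1g. Qed.
Lemma innV w : inn w^-1 = (inn w)^-1.
Proof. by apply: (@mulgI _ (inn w)); rewrite -innM !mulgV inn1. Qed.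

(** In particular the inner automorphisms form a normal subgroup. *)
Lemma ap_inn f w : f * inn w = inn (f w) * f.
Proof. by apply: aut_ext; rewrite !aut_compE !innE !ap_mul apV. Qed.

Lemma inn_eq1 w : inn w = 1 -> w = 1.
Proof.
move=> e; apply: center_trivial => [|i]; first by exists ord0, ord_max.
have /(congr1 (fun f : aut_plus => f (fg_gen i))) := e.
by rewrite innE aut_1E => {2}<-; rewrite mulgVK.
Qed.

Lemma iota_u : iota_F2 gen_u = gen_v. Proof. exact: endo2u. Qed.
Lemma iota_v : iota_F2 gen_v = gen_u^-1. Proof. exact: endo2v. Qed.
Lemma zeta_u : zeta_F2 gen_u = gen_v. Proof. exact: endo2u. Qed.
Lemma zeta_v : zeta_F2 gen_v = gen_v^-1 * gen_u^-1. Proof. exact: endo2v. Qed.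
Lemma sigma_u : sigma_F2 gen_u = gen_u^-1. Proof. exact: endo2u. Qed.
Lemma sigma_v : sigma_F2 gen_v = gen_v^-1. Proof. exact: endo2v. Qed.
Lemma iotaV_u : iota_F2^-1 gen_u = gen_v^-1.
Proof. by apply: (@ap_inj iota_F2); rewrite apKV apV iota_v invgK. Qed.
Lemma iotaV_v : iota_F2^-1 gen_v = gen_u.
Proof. by apply: (@ap_inj iota_F2); rewrite apKV iota_u. Qed.
Lemma zetaV_v : zeta_F2^-1 gen_v = gen_u.
Proof. by apply: (@ap_inj zeta_F2); rewrite apKV zeta_u. Qed.
Lemma zetaV_u : zeta_F2^-1 gen_u = gen_v^-1 * gen_u^-1.
Proof.
apply: (@ap_inj zeta_F2).
by rewrite apKV ap_mul !apV zeta_u zeta_v invgM !invgK mulgK.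
Qed.

(* Replacing the three automorphisms by variables known only through their
   values on the generators keeps rewriting from evaluating them. *)
Local Ltac gen_compute :=
  move: iota_u iota_v iotaV_u iotaV_v zeta_u zeta_v zetaV_u zetaV_v
    sigma_u sigma_v; generalize iota_F2, zeta_F2, sigma_F2;
  let i := fresh in
  let z := fresh in
  let s := fresh in
  let iu := fresh in
  let iv := fresh in
  let iVu := fresh in
  let iVv := fresh in
  let zu := fresh in
  let zv := fresh in
  let zVu := fresh in
  let zVv := fresh in
  let su := fresh in
  let sv := fresh in
  move=> i z s iu iv iVu iVv zu zv zVu zVv su sv;
  apply: aut_ext;
  rewrite !(aut_compE, aut_1E, ap_mul, apV, iu, iv, iVu, iVv, zu, zv, zVu, zVv, su, sv,
    innE, invgM, invgK, mulgA, mulgK, mulgVK, mulVg, mulgV, mul1g, mulg1).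

Lemma iota2 : iota_F2 * iota_F2 = sigma_F2.
Proof. by gen_compute. Qed.
Lemma sigma2 : sigma_F2 * sigma_F2 = 1.
Proof. by gen_compute. Qed.
Lemma iota4 : iota_F2 ^+ 4 = 1.
Proof. by rewrite (expgnDr _ 2 2) !expg2 iota2 sigma2. Qed.
Lemma zeta3 : zeta_F2 ^+ 3 = 1.
Proof. by rewrite expgS expg2; gen_compute. Qed.
(** The trace in Aut+(F2) of the fact that -I is central: sigma commutes with
    zeta up to an inner automorphism. *)
Lemma zeta_sigma : zeta_F2 * sigma_F2 = inn gen_v^-1 * sigma_F2 * zeta_F2.
Proof. by gen_compute. Qed.

(** The product of zeta and the inverse of iota is the elementary transvection
    (u, v) |-> (uv, v). *)
Lemma transv_u : (zeta_F2 * iota_F2^-1) gen_u = gen_u * gen_v.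
Proof. by rewrite aut_compE iotaV_u apV zeta_v invgM !invgK. Qed.
Lemma transv_v : (zeta_F2 * iota_F2^-1) gen_v = gen_v.
Proof. by rewrite aut_compE iotaV_v zeta_u. Qed.

End AutPlus.


(** * Nielsen reduction *)

Section Reduced.

Variable f : aut_plus.
Implicit Types (a b c : letter 'I_2).

Hypothesis no_shorter : forall a b, a.1 != b.1 ->
  (len (f (letter_elt a)) <= len (f (letter_elt a * letter_elt b)%g))%N.
Hypothesis no_half : forall a b, a.1 != b.1 ->
  (gromov (f (letter_elt a)) (f (letter_elt b))).*2 = len (f (letter_elt b)) ->
  (gromov (f (letter_elt a))^-1%g (f (letter_elt b))^-1%g).*2 = len (f (letter_elt b)) -> False.

Let canc a b := gromov (f (letter_elt a))^-1 (f (letter_elt b)).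

Let img_neq1 a : f (letter_elt a) <> 1.
Proof. by rewrite -(ap1 f) => /ap_inj e; have := len_letter a; rewrite e. Qed.

Let img_gt0 a : (0 < len (f (letter_elt a)))%N.
Proof. by rewrite lt0n; apply/eqP => /len_eq0/img_neq1. Qed.

Let letter_eq a b : b != letter_inv a -> (a.1 != b.1) || (b == a).
Proof.
case: a b => i [] [j []] //=; rewrite /letter_inv /=;
  by case: (i =P j) => [->|] //=; rewrite eqxx.
Qed.

Let canc_self a : ((canc a a).*2 < len (f (letter_elt a)))%N.
Proof. by rewrite /canc gromovC; exact: gromovV_lt. Qed.

Let canc_half a b : b != letter_inv a ->
  ((canc a b).*2 <= len (f (letter_elt a)))%N /\ ((canc a b).*2 <= len (f (letter_elt b)))%N.
Proof.
move=> /letter_eq/orP[nab|/eqP ->]; last by have := canc_self a; lia.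
have := len_divl (f (letter_elt a))^-1 (f (letter_elt b)).
rewrite invgK lenV -/(canc a b) -ap_mul => e.
have h1 := no_shorter nab.
have eV : (letter_elt b)^-1 * (letter_elt a)^-1 = (letter_elt a * letter_elt b)^-1 by rewrite invgM.
have := @no_shorter (letter_inv b) (letter_inv a).
rewrite !letter_eltV eV !apV !lenV /= eq_sym => /(_ nab) h2.
have arith (m k l n : nat) : (m + n.*2 = k + l -> k <= m -> l <= m ->
    n.*2 <= k /\ n.*2 <= l)%N by lia.
exact: arith e h1 h2.
Qed.

(** Each neighbour cancels at most half of the image of b. If both cancel
    exactly half, then a and c are letters of the other generator. When c is the
    inverse of a, the image of b shares half of its letters with its inverse,
    contrary to [gromovV_lt]; when c = a, this is the excluded tie. *)
Let canc_triple a b c : b != letter_inv a -> c != letter_inv b ->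
  (canc a b + canc b c < len (f (letter_elt b)))%N.
Proof.
move=> hab hbc.
have [_ h1] := canc_half hab; have [h2 _] := canc_half hbc.
case/orP: (letter_eq hab) => [nab|/eqP e]; last first.
  by subst b; have := canc_self a; lia.
case/orP: (letter_eq hbc) => [nbc|/eqP e]; last first.
  by subst c; have := canc_self b; lia.
rewrite ltnNge; apply/negP => h.
have e1 : ((canc a b).*2 = len (f (letter_elt b)))%N by lia.
have e2 : ((canc b c).*2 = len (f (letter_elt b)))%N by lia.
have eca : c.1 = a.1.
  have [ea|/ord2P ea] := eqVneq a.1 ord0; have [ec|/ord2P ec] := eqVneq c.1 ord0;
  have [eb|/ord2P eb] := eqVneq b.1 ord0; rewrite ?ea ?eb ?ec ?eqxx // in nab nbc *.
have [ec|nc] := eqVneq c (letter_inv a).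
  have arith (k l m n : nat) : (k.*2 = n -> l.*2 = n -> m.*2 < n ->
      minn k l <= m -> False)%N by lia.
  apply: (arith _ _ _ _ e1 e2 (gromovV_lt (@img_neq1 b))).
  rewrite /canc gromovC [gromov (f (letter_elt b))^-1 _]gromovC ec letter_eltV apV.
  exact: gromov_ultra.
have ec : c = a.
  by move: nc eca; case: (a) (c) => i [] [j []] //= + e; rewrite /letter_inv /= e // eqxx.
subst c; apply: (@no_half (letter_inv a) b) => //; rewrite letter_eltV apV //.
by rewrite invgK gromovC.
Qed.

(** The part of the image of a that is lost to the next letter of a word a s. *)
Let canc_hd a (s : seq (letter 'I_2)) : nat := if s is b :: _ then canc a b else 0%N.

(** Every letter of the reduced word w leaves a nonempty part of its image in f
    w, because its two neighbours together cancel less than the whole image. The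
    induction keeps track of the part of the first image that survives. *)
Lemma len_image w : (size (word w) <= len (f w))%N.
Proof.
suff: forall a s, word w = a :: s ->
  [/\ (canc_hd a s < len (f (letter_elt a)))%N,
     (size s + (len (f (letter_elt a)) - canc_hd a s) <= len (f w))%N &
     (len (f (letter_elt a)) - canc_hd a s <= gromov (f (letter_elt a)) (f w))%N].
  by case: (word w) => // a s /(_ a s erefl)[]; rewrite /=; lia.
elim/letter_ind: w => // a w rw IH a' s'.
have ew : word (letter_elt a * w) = a :: word w.
  by rewrite word_letterM; case: (word w) rw => //= b s /andP[/negbTE -> _].
rewrite ew => -[<- <-] {a' s'}.
case: w rw IH ew => -[|b s] rs rw IH ew.
  rewrite (_ : FreeGroup rs = 1); last exact: val_inj.
  rewrite mulg1 /=; split => //; rewrite ?subn0 ?add0n //.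
  by have := len_divl (f (letter_elt a)) (f (letter_elt a)); rewrite mulVg len1; lia.
set w := FreeGroup rs in IH ew *.
have [h1 h2 h3] := IH b s erefl.
have hab : b != letter_inv a by case/andP: rw.
have [h4 h5] := canc_half hab.
have h6 : (canc a b + canc_hd b s < len (f (letter_elt b)))%N.
  case: s rs {w IH h1 h2 h3 ew} rw => [|c s] rs rw /=.
    by have := img_gt0 b; lia.
  by case/and3P: rw => _ hbc _; exact: canc_triple.
have g1 := gromov_ultra (f (letter_elt a))^-1 (f (letter_elt b)) (f w).
have g2 := gromov_ultra (f (letter_elt a))^-1 (f w) (f (letter_elt b)).
rewrite (gromovC (f w)) in g2; rewrite -/(canc a b) in g1 g2.
have l1 := len_divl (f (letter_elt a))^-1 (f w); rewrite invgK lenV in l1.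
have l2 := len_divl (f (letter_elt a)) (f (letter_elt a) * f w); rewrite mulKg in l2.
have arith (la lb lw lm k1 k2 k3 g h m : nat) :
  (k1 < lb -> m + (lb - k1) <= lw -> lb - k1 <= k3 -> k2.*2 <= la ->
   k2 + k1 < lb -> minn k2 k3 <= g -> minn g k3 <= k2 -> lm + g.*2 = la + lw ->
   lw + h.*2 = la + lm -> 0 < la ->
   [/\ k2 < la, m.+1 + (la - k2) <= lm & la - k2 <= h])%N.
  by move=> *; split; lia.
rewrite ap_mul.
exact: (arith _ _ _ _ _ _ _ _ _ _ h1 h2 h3 h4 h6 g1 g2 l1 l2 (img_gt0 a)).
Qed.

End Reduced.

Lemma rho_mx2 (f : autom F2) : rho f =
  mx2 (exp_sum ord0 (f gen_u)) (exp_sum ord0 (f gen_v))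
      (exp_sum ord_max (f gen_u)) (exp_sum ord_max (f gen_v)).
Proof.
apply/matrixP => i j; rewrite !mxE.
by case: (eqVneq i ord0) => [->|/ord2P ->]; case: (eqVneq j ord0) => [->|/ord2P ->].
Qed.

Lemma det_rho (f : aut_plus) :
  (exp_sum ord0 (f gen_u) * exp_sum ord_max (f gen_v) -
   exp_sum ord0 (f gen_v) * exp_sum ord_max (f gen_u) = 1)%R.
Proof. by rewrite -det_mx2 -rho_mx2; case: f => f /= /eqP. Qed.

(** The action of iota on the letters, which rotates u, v, u^-1, v^-1
    cyclically. *)
Definition quarter_turn (a : letter 'I_2) : letter 'I_2 :=
  if a.1 == ord0 then (ord_max, a.2) else (ord0, ~~ a.2).

Lemma ord2_case (i : 'I_2) : i = ord0 \/ i = ord_max.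
Proof. by have [->|/ord2P ->] := eqVneq i ord0; [left|right]. Qed.

Lemma iota_letter a : iota_F2 (letter_elt a) = letter_elt (quarter_turn a).
Proof.
case: a => i b; rewrite /letter_elt /quarter_turn.
have [->|->] := ord2_case i; case: b.
- by rewrite -[LHS]/(iota_F2 gen_u^-1) apV iota_u.
- exact: iota_u.
- by rewrite -[LHS]/(iota_F2 gen_v^-1) apV iota_v invgK.
- exact: iota_v.
Qed.

Section Generation.

Variable P : aut_plus -> Prop.
Hypotheses (P_1 : P 1) (P_inn : forall w f, P f -> P (inn w * f))
  (P_iota : forall f, P f -> P (f * iota_F2))
  (P_zeta : forall f, P f -> P (f * zeta_F2)).
Implicit Types (f g h : aut_plus) (a b : letter 'I_2).

(** Right multiplication by such an h preserves and reflects P; these h form a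
    subgroup, which contains the Nielsen transvections. *)
Let stable h := forall f, P (f * h) <-> P f.

Let stableM g h : stable g -> stable h -> stable (g * h).
Proof. by move=> sg sh f; rewrite mulgA (sh (f * g)); exact: sg. Qed.

Let stableV h : stable h -> stable h^-1.
Proof. by move=> sh f; rewrite -(sh (f * h^-1)) mulgVK. Qed.

Let stable_iota : stable iota_F2.
Proof.
move=> f; split=> [Pf|]; last exact: P_iota.
by rewrite -[f]mulg1 -iota4 !expgS mulg1 !mulgA; do 3!apply: P_iota.
Qed.

Let stable_zeta : stable zeta_F2.
Proof.
move=> f; split=> [Pf|]; last exact: P_zeta.
by rewrite -[f]mulg1 -zeta3 !expgS mulg1 !mulgA; do 2!apply: P_zeta.
Qed.

(** Up to a conjugation by a power of iota, h is (u, v) |-> (uv, v) or its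
    inverse. *)
Let transvection a b : a.1 != b.1 -> exists h,
  [/\ stable h, h (letter_elt a) = letter_elt a * letter_elt b & h (letter_elt b) = letter_elt b].
Proof.
pose T a b := exists h, [/\ stable h,
  h (letter_elt a) = letter_elt a * letter_elt b & h (letter_elt b) = letter_elt b].
have rot c d : T c d -> T (quarter_turn c) (quarter_turn d).
  case=> h [sh hc hd]; exists (iota_F2 * h * iota_F2^-1); split.
  - by apply: stableM; [apply: stableM | apply: stableV].
  - by rewrite !aut_compE -!iota_letter apVK hc ap_mul.
  - by rewrite !aut_compE -!iota_letter apVK hd.
have base e : T (ord0, false) (ord_max, e).
  have sR : stable (zeta_F2 * iota_F2^-1) by apply: stableM => //; apply: stableV.
  case: e; last first.
    by exists (zeta_F2 * iota_F2^-1); split; [|exact: transv_u|exact: transv_v].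
  have tv : (zeta_F2 * iota_F2^-1)^-1 gen_v = gen_v.
    by rewrite -{1}transv_v apVK.
  exists (zeta_F2 * iota_F2^-1)^-1; split; first exact: stableV.
    apply: (@mulIg _ gen_v).
    have -> : letter_elt (ord0, false) * letter_elt (ord_max, true) * gen_v = gen_u :> F2.
      by rewrite mulgVK.
    rewrite -[letter_elt (ord0, false)]/gen_u -{1}tv -ap_mul -transv_u.
    exact: apVK.
  by rewrite apV tv.
have turn1 d : T (ord_max, false) (ord0, d).
  by have := rot _ _ (base (~~ d)); rewrite /quarter_turn /= negbK.
have turn2 d : T (ord0, true) (ord_max, d) := rot _ _ (turn1 d).
have turn3 d : T (ord_max, true) (ord0, d).
  by have := rot _ _ (turn2 (~~ d)); rewrite /quarter_turn /= negbK.
rewrite -/(T a b); case: a b => i b [j c] /=.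
have [->|->] := ord2_case i; have [->|->] // := ord2_case j => _.
  by case: b; [exact: turn2 | exact: base].
by case: b; [exact: turn3 | exact: turn1].
Qed.

Let mu f := (len (f gen_u) + len (f gen_v))%N.

Let muE f a b : a.1 != b.1 -> mu f = (len (f (letter_elt a)) + len (f (letter_elt b)))%N.
Proof.
have E c : len (f (letter_elt c)) = len (f (fg_gen c.1)).
  by case: c => i []; rewrite /letter_elt //= apV lenV.
rewrite !E /mu; case: a b => i _ [j _] /=.
have [->|->] := ord2_case i; have [->|->] // := ord2_case j => _.
exact: addnC.
Qed.

Let P_letters f a b : f^-1 gen_u = letter_elt a -> f^-1 gen_v = letter_elt b -> P f.
Proof.
move=> eu ev.
suff sf : stable f^-1 by apply/(sf f); rewrite mulgV.
have := det_rho f^-1; rewrite eu ev.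
have s1 : stable 1 by move=> g; rewrite mulg1.
have sk k : stable (iota_F2 ^+ k).
  by elim: k => // k IH; rewrite expgS; apply: stableM.
have fin k : (iota_F2 ^+ k) gen_u = letter_elt a ->
    (iota_F2 ^+ k) gen_v = letter_elt b -> stable f^-1.
  move=> ku kv; rewrite (_ : f^-1 = iota_F2 ^+ k) //.
  by apply: aut_ext; rewrite ?eu ?ev.
have u2 : (iota_F2 ^+ 2) gen_u = gen_u^-1 by rewrite expg2 iota2 sigma_u.
have v2 : (iota_F2 ^+ 2) gen_v = gen_v^-1 by rewrite expg2 iota2 sigma_v.
have u3 : (iota_F2 ^+ 3) gen_u = gen_v^-1 by rewrite expgS aut_compE u2 apV iota_u.
have v3 : (iota_F2 ^+ 3) gen_v = gen_u.
  by rewrite expgS aut_compE v2 apV iota_v invgK.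
move: fin; case: (a) (b) => i c [j d].
have [->|->] := ord2_case i; have [->|->] := ord2_case j; case: c; case: d => fin;
  rewrite /letter_elt /= !exp_sumE => /eqP //= _.
all: first [exact: (fin 0%N erefl erefl) | exact: (fin 1%N iota_u iota_v)
  | exact: (fin 2%N u2 v2) | exact: (fin 3%N u3 v3)].
Qed.

(** The inner automorphisms, iota and zeta generate Aut+(F2). A counterexample f
    with |f u| + |f v| minimal admits no shortening transvection, with or
    without a conjugation, so [len_image] applies: the preimage of a letter has
    length at most 1. Hence the inverse of f permutes the letters, and having
    determinant 1 it is a power of iota. *)
Theorem aut_plus_ind f : P f.
Proof.
have [n] := ubnP (mu f); elim: n f => // n IH f; rewrite ltnS => lemu.
apply: contrapT => nP.
have minimal w h : stable h -> (mu f <= mu (inn w * f * h)%g)%N.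
  move=> sh; rewrite leqNgt; apply/negP => lt_mu; apply: nP.
  have /sh Pwf := IH _ (leq_trans lt_mu lemu).
  by rewrite -(mulKg (inn w) f) -innV; exact: P_inn.
have no_shorter a b : a.1 != b.1 ->
    (len (f (letter_elt a)) <= len (f (letter_elt a * letter_elt b)%g))%N.
  move=> nab; have [h [sh ha hb]] := transvection nab.
  have := minimal 1 h sh; rewrite inn1 mul1g !(muE _ nab) !aut_compE ha hb.
  by rewrite leq_add2r.
have no_half a b : a.1 != b.1 ->
    (gromov (f (letter_elt a)) (f (letter_elt b))).*2 = len (f (letter_elt b)) ->
    (gromov (f (letter_elt a))^-1%g (f (letter_elt b))^-1%g).*2 = len (f (letter_elt b)) -> False.
  move=> nab g1 g2.
  have [h [sh ha hb]] := @transvection a (letter_inv b) nab.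
  have nfb : f (letter_elt b) <> 1.
    by rewrite -(ap1 f) => /ap_inj e; have := len_letter b; rewrite e.
  have lba : (len (f (letter_elt b)) <= len (f (letter_elt a)))%N.
    have := @no_shorter (letter_inv b) a.
    rewrite letter_eltV ap_mul apV lenV eq_sym => /(_ nab) h1.
    have h2 := len_divl (f (letter_elt b)) (f (letter_elt a)).
    rewrite gromovC g1 in h2.
    have arith (k l m : nat) : (k <= m -> m + k = k + l -> k <= l)%N by lia.
    exact: arith h1 h2.
  (* Conjugating by q^-1 the pair obtained from the transvection a |-> a b^-1
     contradicts minimality. *)
  have [q] := half_cancel nfb g1 g2 lba.
  have := minimal q^-1 h sh.
  have hb' : h (letter_elt b) = letter_elt b.
    by apply: invg_inj; rewrite -apV -letter_eltV hb.
  rewrite !(muE _ nab) !aut_compE ha hb' !innE invgK letter_eltV ap_mul apV => h1 h2.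
  by have := leq_trans h2 h1; rewrite ltnn.
have inv_letter a : exists b, f^-1 (letter_elt a) = letter_elt b.
  apply: len1P; apply/eqP; rewrite eqn_leq.
  have := len_image no_shorter no_half (f^-1 (letter_elt a)); rewrite apKV len_letter => -> /=.
  rewrite lt0n; apply/eqP => /len_eq0 e.
  by have := len_letter a; rewrite -(apKV f (letter_elt a)) e ap1.
have [a ea] := inv_letter (ord0, false); have [b eb] := inv_letter (ord_max, false).
exact: nP (P_letters ea eb).
Qed.

End Generation.

(** * Automorphisms acting trivially on the abelianization *)

Section Matrices.
Implicit Types (a b c d : int).

Lemma mx2_eta (A : 'M[int]_2) :
  A = mx2 (A ord0 ord0) (A ord0 ord_max) (A ord_max ord0) (A ord_max ord_max).
Proof.
apply/matrixP => i j; rewrite !mxE.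
by case: (ord2_case i) => ->; case: (ord2_case j) => ->.
Qed.

Lemma mx2_inj a b c d a' b' c' d' : mx2 a b c d = mx2 a' b' c' d' ->
  [/\ a = a', b = b', c = c' & d = d'].
Proof.
move=> e; have E i j := congr1 (fun A : 'M[int]_2 => A i j) e.
move: (E ord0 ord0) (E ord0 ord_max) (E ord_max ord0) (E ord_max ord_max).
by rewrite !mxE.
Qed.

Lemma mx2_mul a b c d a' b' c' d' :
  (mx2 a b c d *m mx2 a' b' c' d' =
   mx2 (a * a' + b * c') (a * b' + b * d') (c * a' + d * c') (c * b' + d * d'))%R.
Proof.
apply/matrixP => i j; rewrite !mxE !big_ord_recl big_ord0 !mxE addr0.
by case: (ord2_case i) => ->; case: (ord2_case j) => ->.
Qed.

Lemma mx2_1 : 1%:M%R = mx2 1 0 0 1.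
Proof.
apply/matrixP => i j; rewrite !mxE.
by case: (ord2_case i) => ->; case: (ord2_case j) => ->.
Qed.

End Matrices.

Lemma rho_iota : rho iota_F2 = mx2 0 (-1) 1 0.
Proof. by rewrite rho_mx2 iota_u iota_v !exp_sumE. Qed.

Lemma rho_zeta : rho zeta_F2 = mx2 0 (-1) 1 (-1).
Proof. by rewrite rho_mx2 zeta_u zeta_v !exp_sumE. Qed.

Lemma expg4_mod (G : groupType) (x : G) n : x ^+ 4 = 1 -> x ^+ n = x ^+ (n %% 4).
Proof.
by move=> x4; rewrite {1}(divn_eq n 4) expgnDr mulnC expgnA x4 expg1n mul1g.
Qed.

Section Kernel.
Implicit Types (f g h p : aut_plus).

(** Equality of the classes in Out(F2). *)
Definition out_eq f g := exists w, f = inn w * g.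
Local Notation "f ~= g" := (out_eq f g) (at level 70).

Lemma out_refl f : f ~= f. Proof. by exists 1; rewrite inn1 mul1g. Qed.

Lemma out_trans f g h : f ~= g -> g ~= h -> f ~= h.
Proof. by move=> [w ->] [w' ->]; exists (w * w'); rewrite innM mulgA. Qed.

Lemma out_mul f f' g g' : f ~= f' -> g ~= g' -> f * g ~= f' * g'.
Proof.
move=> [w ->] [w' ->]; exists (w * f' w').
by rewrite innM -!mulgA; congr (_ * _); rewrite mulgA ap_inn -mulgA.
Qed.

Definition lower := zeta_F2 * iota_F2^-1.
Definition upper := zeta_F2^-1 * iota_F2.

Lemma rho_lower : rho lower = mx2 1 0 1 1.
Proof. by rewrite rho_mx2 transv_u transv_v !exp_sumE. Qed.

Lemma rho_upper : rho upper = mx2 1 1 0 1.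
Proof.
have uu : upper gen_u = gen_u by rewrite aut_compE iota_u zetaV_v.
have uv : upper gen_v = gen_u * gen_v.
  by rewrite aut_compE iota_v apV zetaV_u invgM !invgK.
by rewrite rho_mx2 uu uv !exp_sumE.
Qed.

Inductive positive : aut_plus -> Prop :=
| positive_1 : positive 1
| positive_lower p : positive p -> positive (p * lower)
| positive_upper p : positive p -> positive (p * upper).

Lemma sigma_zeta : sigma_F2 * zeta_F2 ~= zeta_F2 * sigma_F2.
Proof.
by exists gen_v; rewrite zeta_sigma !mulgA -innM mulgV inn1 mul1g.
Qed.

Lemma even_zeta i : iota_F2 ^+ i.*2 * zeta_F2 ~= zeta_F2 * iota_F2 ^+ i.*2.
Proof.
have -> : iota_F2 ^+ i.*2 = sigma_F2 ^+ i.
  by rewrite -mul2n expgnA expg2 iota2.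
elim: i => [|i IH]; first by rewrite expg0 mul1g mulg1; exact: out_refl.
rewrite expgS -mulgA.
apply: out_trans (out_mul (out_refl sigma_F2) IH) _.
by rewrite !mulgA; apply: out_mul (out_refl _); exact: sigma_zeta.
Qed.

(** In the upper half plane: the geodesic from g(0) to g(oo) does not cross the
    one from 0 to oo, hence g has nonnegative entries after multiplication by
    suitable powers of S on both sides. Here the set of such products is shown
    to be closed under right multiplication by zeta. A power of sigma moves to
    the right of zeta; if an odd power of iota remains, it is absorbed into the
    last factor of p by means of zeta = lower iota and zeta^2 = upper iota^-1.
    *)
Lemma positive_form f : exists k j p,
  positive p /\ f ~= iota_F2 ^+ k * p * iota_F2 ^+ j.
Proof.
elim/aut_plus_ind: f => [|w f|f|f].
- exists 0%N, 0%N, 1; split; first exact: positive_1.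
  by rewrite !mulg1; exact: out_refl.
- case=> k [j [p [pp [w' ->]]]]; exists k, j, p; split => //.
  by exists (w * w'); rewrite innM mulgA.
- case=> k [j [p [pp e]]]; exists k, j.+1, p; split => //.
  by rewrite expgSr mulgA; apply: out_mul e (out_refl _).
case=> k [j [p [pp e]]].
suff [k' [j' [p' [pp' e']]]] : exists k' j' p', positive p' /\
   iota_F2 ^+ k * p * iota_F2 ^+ j * zeta_F2 ~= iota_F2 ^+ k' * p' * iota_F2 ^+ j'.
  exists k', j', p'; split => //.
  exact: out_trans (out_mul e (out_refl _)) e'.
have zE : zeta_F2 = lower * iota_F2 by rewrite /lower mulgVK.
have ej := odd_double_half j; set i := j./2 in ej.
case: (odd j) ej => /= <-; last first.
  exists k, i.*2.+1, (p * lower); split; first exact: positive_lower.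
  rewrite add0n expgS -!mulgA; do 2 apply: out_mul (out_refl _) _.
  by apply: out_trans (even_zeta i) _; rewrite mulKg; exact: out_refl.
rewrite add1n expgS.
have step q : q * (iota_F2 * iota_F2 ^+ i.*2) * zeta_F2 ~=
    q * (iota_F2 * zeta_F2) * iota_F2 ^+ i.*2.
  rewrite -!mulgA; do 2 apply: out_mul (out_refl _) _; exact: even_zeta.
case: pp => [|q qq|q qq].
- exists k.+1, i.*2.+1, (1 * lower).
  split; first exact/positive_lower/positive_1.
  apply: out_trans (step _) _.
  by rewrite mulg1 mul1g expgSr expgS {1}zE !mulgA; exact: out_refl.
- exists k, (3 + i.*2)%N, (q * upper); split; first exact: positive_upper.
  apply: out_trans (step _) _.
  have -> : iota_F2 ^+ k * (q * lower) * (iota_F2 * zeta_F2) =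
      iota_F2 ^+ k * q * (zeta_F2 * zeta_F2).
    by rewrite /lower !mulgA mulgVK.
  have -> : zeta_F2 * zeta_F2 = zeta_F2^-1.
    by apply: (@mulgI _ zeta_F2); rewrite mulgV -expg2 -expgS zeta3.
  have -> : iota_F2 ^+ k * (q * upper) * iota_F2 ^+ (3 + i.*2) =
      iota_F2 ^+ k * q * zeta_F2^-1 * iota_F2 ^+ i.*2.
    have i4 : iota_F2 * iota_F2 ^+ 3 = 1 by rewrite -expgS iota4.
    rewrite /upper expgnDr; move: (iota_F2 ^+ 3) i4 => i3 i4.
    by rewrite !mulgA -(mulgA _ iota_F2) i4 mulg1.
  exact: out_refl.
exists k, (2 + i.*2)%N, q; split => //.
apply: out_trans (step _) _; rewrite expgnDr (mulgA _ (iota_F2 ^+ 2)).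
apply: out_mul _ (out_refl _); rewrite expg2 iota2 /upper.
have -> : iota_F2 ^+ k * (q * (zeta_F2^-1 * iota_F2)) * (iota_F2 * zeta_F2) =
    iota_F2 ^+ k * q * zeta_F2^-1 * (sigma_F2 * zeta_F2).
  by rewrite -iota2 !mulgA.
apply: out_trans (out_mul (out_refl _) sigma_zeta) _.
by rewrite mulgA mulgVK; exact: out_refl.
Qed.

(** Each further factor adds one column, which is nonzero, to the other one, so
    the sum of the entries is 2 only for the empty product. *)
Lemma positive_rho p : positive p -> exists a b c d : int,
  [/\ rho p = mx2 a b c d, (0 <= a)%R /\ (0 <= b)%R, (0 <= c)%R /\ (0 <= d)%R,
      (1 <= a + c)%R /\ (1 <= b + d)%R & p = 1 \/ (3 <= a + b + c + d)%R].
Proof.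
elim=> [|q _ [a [b [c [d [e h1 h2 h3 h4]]]]]|q _ [a [b [c [d [e h1 h2 h3 h4]]]]]].
- by exists 1%R, 0%R, 0%R, 1%R; split => //; [rewrite -mx2_1; exact: rho1 | left].
- exists (a + b)%R, b, (c + d)%R, d.
  rewrite rhoM e rho_lower mx2_mul !mulr1 !mulr0 !add0r.
  by split => //; lia.
- exists a, (a + b)%R, c, (c + d)%R.
  rewrite rhoM e rho_upper mx2_mul !mulr1 !mulr0 !addr0.
  by split => //; lia.
Qed.

(** When f acts trivially, the nonnegative matrix of p in [positive_form] is a
    power of S. Its entries add up to at most 2, whence p = 1, and iota^(k+j) =
    1 because S has order 4. *)
Theorem ker_rho f : rho f = 1%:M%R -> exists w, f = inn w.
Proof.
move=> f1; have [k [j [p [pp [w ef]]]]] := positive_form f.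
have [m lm [em1 em2]] : exists2 m, (m < 4)%N &
    (rho p *m rho (iota_F2 ^+ m)%g = 1%:M)%R /\ iota_F2 ^+ (k + j) = iota_F2 ^+ m.
  exists ((k + j) %% 4)%N; first by rewrite ltn_mod.
  rewrite -(expg4_mod _ iota4); split => //.
  move: f1; rewrite ef !rhoM rho_inn mul1mx => e.
  rewrite addnC expgnDr rhoM mulmxA.
  by apply: mulmx1C; rewrite mulmxA.
have [a [b [c [d [e h1 h2 h3 h4]]]]] := positive_rho pp.
have p1 : m = 0%N /\ p = 1.
  move: em1; rewrite e; case: m lm {em2} => [|[|[|[|//]]]] _.
  - rewrite expg0 rho1 mulmx1 mx2_1 => /mx2_inj[ea eb ec ed].
    by split => //; case: h4 => // h4; lia.
  - rewrite expg1 rho_iota mx2_mul mx2_1 => /mx2_inj[ea eb ec ed]; lia.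
  - rewrite expg2 rhoM rho_iota !mx2_mul mx2_1 => /mx2_inj[ea eb ec ed]; lia.
  - rewrite expgS expg2 !rhoM rho_iota !mx2_mul mx2_1 => /mx2_inj[ea eb ec ed]; lia.
exists w; rewrite ef; case: p1 em2 => -> -> em2.
by rewrite mulg1 -expgnDr em2 expg0 mulg1.
Qed.
End Kernel.

(** * Torsion in twisted extensions of word groups *)

Section TwistedTorsion.

Variables (G : groupType) (A : eqType) (inv : A -> A) (ev : A -> G).
Variables (t : G) (phi : A -> A) (n : nat).
Implicit Types (a b : A) (s : seq A).

Definition ev_word s : G := foldr (fun a g => ev a * g) 1 s.
Definition no_backtrack s : bool := sorted (fun a b => b != inv a) s.

Hypotheses (invK : involutive inv) (ev_inv : forall a, ev (inv a) = (ev a)^-1).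
Hypotheses (phi_inj : injective phi) (phi_inv : forall a, phi (inv a) = inv (phi a)).
Hypothesis ev_phi : forall a, t * ev a = ev (phi a) * t.
Hypothesis faithful : forall s, no_backtrack s -> ev_word s = 1 -> s = [::].
Hypotheses (n_gt0 : (0 < n)%N) (tn : t ^+ n = 1).

Let ev_cat s1 s2 : ev_word (s1 ++ s2) = ev_word s1 * ev_word s2.
Proof. by elim: s1 => [|a s1 IH] /=; rewrite ?mul1g // IH mulgA. Qed.

Let ev_map s : t * ev_word s = ev_word (map phi s) * t.
Proof. by elim: s => [|a s IH] /=; rewrite ?mul1g ?mulg1 // mulgA ev_phi -!mulgA IH. Qed.

(** The word s, phi(s), phi(phi(s)), and so on, with k blocks. *)
Fixpoint twisted_power s k : seq A :=
  if k is k'.+1 then s ++ map phi (twisted_power s k') else [::].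

Let ev_power s k : ev_word (twisted_power s k) * t ^+ k = (ev_word s * t) ^+ k.
Proof.
elim: k => [|k IH]; first by rewrite !expg0 mulg1.
by rewrite !expgS -IH /= ev_cat -!mulgA; congr (_ * _); rewrite !mulgA ev_map.
Qed.

Let no_backtrack_map s : no_backtrack s -> no_backtrack (map phi s).
Proof.
by rewrite /no_backtrack sorted_map; apply: sub_sorted => a b /=;
  rewrite -phi_inv (inj_eq phi_inj).
Qed.

Let no_backtrack_power a s k : no_backtrack (a :: s) ->
  phi a != inv (last a s) -> no_backtrack (twisted_power (a :: s) k).
Proof.
move=> rs h; elim: k => // k IH.
rewrite /= /no_backtrack /= cat_path [path _ _ s]rs /=.
by have := no_backtrack_map IH; case: (k) => //= k'; rewrite /no_backtrack /= h.
Qed.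

(** If the last letter of s does not cancel against phi of its first letter, the
    twisted powers of s are reduced, so (ev(s) t)^n is not 1. If it does,
    conjugation by the first letter removes both letters, unless s is a single
    letter a with phi a = a^-1. Geometrically, ev(s) t fixes a vertex of a tree
    or inverts an edge. *)
Theorem twisted_torsion s : no_backtrack s -> (ev_word s * t) ^+ n = 1 ->
  (exists h, (ev_word s * t) ^ h = t) \/
  (exists a h, phi a = inv a /\ (ev_word s * t) ^ h = ev a * t).
Proof.
have [m] := ubnP (size s); elim: m s => // m IH [|a s] sz rs sn.
  by left; exists 1; rewrite mul1g conjg1.
have [e|ne] := eqVneq (phi a) (inv (last a s)); last first.
  have E : ev_word (twisted_power (a :: s) n) = 1.
    by rewrite -sn -ev_power tn mulg1.
  by have := faithful (no_backtrack_power n rs ne) E; case: n n_gt0.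
case: (lastP s) sz rs sn e => [|s' b] sz rs sn e.
  by right; exists a, 1; rewrite conjg1 /= mulg1.
rewrite last_rcons in e.
have eb : b = inv (phi a) by rewrite e invK.
have conj_a : (ev_word (a :: rcons s' b) * t) ^ ev a = ev_word s' * t.
  rewrite conjgE -cats1 /= ev_cat /= eb ev_inv mulg1 -!mulgA mulKg.
  by rewrite ev_phi mulKg.
have rs' : no_backtrack s'.
  by move: rs; rewrite /no_backtrack /= rcons_path => /andP[/path_sorted].
have sn' : (ev_word s' * t) ^+ n = 1 by rewrite -conj_a -conjXg sn conj1g.
have sz' : (size s' < m)%N by move: sz; rewrite /= size_rcons; lia.
case: (IH s' sz' rs' sn') => [[h eh]|[c [h [ec eh]]]]; [left|right].
  by exists (ev a * h); rewrite conjgM conj_a.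
by exists c, (ev a * h); rewrite conjgM conj_a.
Qed.

End TwistedTorsion.

Section LetterWords.
Implicit Types (w : F2) (a : letter 'I_2).

Local Notation ev_inn := (fun a : letter 'I_2 => inn (letter_elt a)).

Lemma ev_inn_word w : ev_word ev_inn (word w) = inn w.
Proof.
elim/letter_ind: w => [|a w rw IH]; first by rewrite inn1.
have -> : word (letter_elt a * w) = a :: word w.
  by rewrite word_letterM; case: (word w) rw => //= b s /andP[/negbTE -> _].
by rewrite innM -IH.
Qed.

Lemma ev_inn_faithful s : no_backtrack (@letter_inv 'I_2) s ->
  ev_word ev_inn s = 1 -> s = [::].
Proof.
move=> rs; rewrite -[s]/(word (FreeGroup rs)) ev_inn_word => /inn_eq1 ->.
by [].
Qed.

Lemma twisted_inn (t : aut_plus) (phi : letter 'I_2 -> letter 'I_2) n w :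
  injective phi -> (forall a, phi (letter_inv a) = letter_inv (phi a)) ->
  (forall a, t (letter_elt a) = letter_elt (phi a)) -> (0 < n)%N -> t ^+ n = 1 ->
  (inn w * t) ^+ n = 1 ->
  (exists h, (inn w * t) ^ h = t) \/
  (exists a h, phi a = letter_inv a /\ (inn w * t) ^ h = inn (letter_elt a) * t).
Proof.
move=> phi_inj phi_inv t_phi n_gt0 tn.
rewrite -(ev_inn_word w); apply: (twisted_torsion (phi := phi)) => //.
- exact: letter_invK.
- by move=> a; rewrite letter_eltV innV.
- by move=> a; rewrite ap_inn t_phi.
- exact: ev_inn_faithful.
- by case: w.
Qed.

(** The twisted statement with t = 1 and phi the identity, as no letter is its
    own inverse. *)
Lemma inn_torsion_free w n : (0 < n)%N -> inn w ^+ n = 1 -> inn w = 1.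
Proof.
move=> n_gt0 wn.
have := @twisted_inn 1 id n w (fun _ _ => id) (fun=> erefl) (fun=> erefl) n_gt0.
rewrite expg1n mulg1 => /(_ erefl wn) [[h /eqP]|[a [h [/eqP]]]].
  by rewrite conjg_eq1 => /eqP.
by rewrite eq_sym (negbTE (letter_inv_neq a)).
Qed.

Lemma quarter_turn_inv a : quarter_turn (letter_inv a) = letter_inv (quarter_turn a).
Proof. by case: a => i b; rewrite /quarter_turn /letter_inv /=; case: eqP. Qed.

Lemma quarter_turn2 a : quarter_turn (quarter_turn a) = letter_inv a.
Proof.
by case: a => i b; case: (ord2_case i) => ->.
Qed.

Lemma quarter_turn_inj : injective quarter_turn.
Proof.
move=> a b /(congr1 quarter_turn); rewrite !quarter_turn2.
exact: (can_inj (@letter_invK _)).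
Qed.

Lemma quarter_turn_neq a : quarter_turn a <> letter_inv a.
Proof. by case: a => i b; case: (ord2_case i) => ->. Qed.

(** A quarter turn sends no letter to its inverse. *)
Lemma conj_iota w : (inn w * iota_F2) ^+ 4 = 1 ->
  conjugate (inn w * iota_F2) iota_F2.
Proof.
case/(@twisted_inn _ _ 4 _ quarter_turn_inj quarter_turn_inv iota_letter isT iota4).
  by case=> h e; exists h.
by case=> a [h [/quarter_turn_neq]].
Qed.

(** Since sigma inverts every letter, the products inn(a) sigma with a letter a
    remain. They are permuted cyclically by iota, and one of them, inn(v^-1)
    sigma, is the conjugate of sigma by zeta. *)
Lemma conj_sigma w : (inn w * sigma_F2) ^+ 2 = 1 ->
  conjugate (inn w * sigma_F2) sigma_F2.
Proof.
have sigma_letter a : sigma_F2 (letter_elt a) = letter_elt (letter_inv a).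
  by rewrite -iota2 aut_compE !iota_letter quarter_turn2.
have inv_inj : injective (@letter_inv 'I_2) by exact: can_inj (@letter_invK _).
have s2 : sigma_F2 ^+ 2 = 1 by rewrite expg2 sigma2.
case/(@twisted_inn _ _ 2 _ inv_inj (fun _ => erefl) sigma_letter isT s2).
  by case=> h e; exists h.
case=> a [h [_ e]].
suff [g eg] : conjugate (inn (letter_elt a) * sigma_F2) sigma_F2.
  by exists (h * g); rewrite conjgM e.
have iota_sigma : iota_F2 * sigma_F2 = sigma_F2 * iota_F2 by rewrite -iota2 mulgA.
have rot c : conjugate (inn (letter_elt (quarter_turn c)) * sigma_F2) sigma_F2 ->
    conjugate (inn (letter_elt c) * sigma_F2) sigma_F2.
  case=> g eg; exists (iota_F2^-1 * g); rewrite conjgM.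
  suff -> : (inn (letter_elt c) * sigma_F2) ^ iota_F2^-1 =
    inn (letter_elt (quarter_turn c)) * sigma_F2 by [].
  by rewrite conjgE invgK !mulgA ap_inn iota_letter -(mulgA _ iota_F2) iota_sigma mulgA mulgK.
have base : conjugate (inn (letter_elt (ord_max, true)) * sigma_F2) sigma_F2.
  exists zeta_F2; rewrite conjgE -[letter_elt _]/(gen_v^-1).
  by rewrite -zeta_sigma mulKg.
case: a {e} => i b; case: (ord2_case i) => ->; case: b.
- exact: rot (ord0, true) base.
- exact: rot (ord0, false) (rot (ord_max, false) (rot (ord0, true) base)).
- exact: base.
- exact: rot (ord_max, false) (rot (ord0, true) base).
Qed.

End LetterWords.

Section ThreeInvolutions.
Implicit Types (x y : 'I_3) (s : seq 'I_3) (w : F2).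

(** In the free product of the groups of order 2 generated by a, b, c (numbered
    0, 1, 2), with u = ab and v = bc, this is the even word x b. *)
Definition side x : F2 :=
  if val x is i.+1 then if i is 0 then 1 else gen_v^-1 else gen_u.

(** Conjugation by the involution x of the free product, restricted to F2;
    conjugation by b is sigma. *)
Definition invol x : aut_plus := inn (side x) * sigma_F2.

Definition push3 x s : seq 'I_3 :=
  if s is y :: s' then if y == x then s' else x :: s else [:: x].

Local Notation red3 := (no_backtrack (@id 'I_3)).
Local Notation c0 := (@Ordinal 3 0 isT).
Local Notation c1 := (@Ordinal 3 1 isT).
Local Notation c2 := (@Ordinal 3 2 isT).

Lemma ord3P x : [\/ x = c0, x = c1 | x = c2].
Proof.
case: x => -[|[|[|n]]] lt3 //.
- by apply: Or31; apply: val_inj.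
- by apply: Or32; apply: val_inj.
- by apply: Or33; apply: val_inj.
Qed.

Lemma push3_red x s : red3 s -> red3 (push3 x s).
Proof.
case: s => //= y s rs; case: eqP => [e|/eqP ne]; first exact: path_sorted rs.
by rewrite /no_backtrack /= ne.
Qed.

Lemma push3K x s : red3 s -> push3 x (push3 x s) = s.
Proof.
case: s => [|y s] /= rs; first by rewrite eqxx.
case: eqP rs => [->|_] /=; last by rewrite eqxx.
by case: s => //= z s; rewrite /no_backtrack /= => /andP[/negbTE ->].
Qed.

Definition letter_push (a : letter 'I_2) s : seq 'I_3 :=
  if a.1 == ord0 then
    if a.2 then push3 c1 (push3 c0 s) else push3 c0 (push3 c1 s)
  else if a.2 then push3 c2 (push3 c1 s) else push3 c1 (push3 c2 s).

(** The reduced word in the three involutions that represents w, obtained by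
    letting w act on the empty word. *)
Definition tree_word w : seq 'I_3 := foldr letter_push [::] (word w).

Lemma letter_push_red a s : red3 s -> red3 (letter_push a s).
Proof.
by move=> rs; rewrite /letter_push; case: ifP => _; case: ifP => _;
  do 2!apply: push3_red.
Qed.

Lemma letter_pushK a s : red3 s -> letter_push (letter_inv a) (letter_push a s) = s.
Proof.
move=> rs; case: a => i b; rewrite /letter_push /=.
by case: eqP; case: b => /= _; rewrite !push3K //; apply: push3_red.
Qed.

Lemma tree_word_red w : red3 (tree_word w).
Proof.
by rewrite /tree_word; elim: (word w) => //= a s; exact: letter_push_red.
Qed.

Lemma tree_word_letter a w : tree_word (letter_elt a * w) = letter_push a (tree_word w).
Proof.
rewrite /tree_word word_letterM; have := tree_word_red w; rewrite /tree_word.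
case: (word w) => //= b s; case: eqP => //= -> rs.
have rs' : red3 (foldr letter_push [::] s).
  by elim: (s) => //= c s' ; exact: letter_push_red.
by rewrite -{1}[a]letter_invK letter_pushK.
Qed.

Lemma tree_word_side x w : tree_word (side x * w) = push3 x (push3 c1 (tree_word w)).
Proof.
have rw := tree_word_red w.
case: (ord3P x) => ->.
- exact: (tree_word_letter (ord0, false)).
- by rewrite mul1g push3K.
- exact: (tree_word_letter (ord_max, true)).
Qed.

Lemma tree_word_sideV x w :
  tree_word ((side x)^-1 * w) = push3 c1 (push3 x (tree_word w)).
Proof.
have rw := tree_word_red w.
case: (ord3P x) => ->.
- exact: (tree_word_letter (ord0, true)).
- by rewrite invg1 mul1g push3K.
- rewrite invgK; exact: (tree_word_letter (ord_max, false)).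
Qed.

Lemma sigma_side x : sigma_F2 (side x) = (side x)^-1.
Proof.
case: (ord3P x) => ->; first exact: sigma_u.
  by rewrite ap1 invg1.
by rewrite apV sigma_v.
Qed.

Lemma involM x y : invol x * invol y = inn (side x * (side y)^-1).
Proof.
rewrite /invol !mulgA -(mulgA (inn _)) ap_inn sigma_side innM -!mulgA.
by rewrite sigma2 mulg1.
Qed.

Lemma invol2 x : invol x * invol x = 1.
Proof. by rewrite involM mulgV inn1. Qed.

Lemma ev_push3 x s : ev_word invol (push3 x s) = invol x * ev_word invol s.
Proof.
by case: s => //= y s; case: eqP => // ->; rewrite mulgA invol2 mul1g.
Qed.

Lemma inn_ev_invol w : exists2 s, red3 s & inn w = ev_word invol s.
Proof.
elim/fg_ind: w => [|i w [s rs e]|i w [s rs e]]; first by exists [::]; rewrite ?inn1.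
- rewrite innM e; case: (ord2_case i) => ->.
    exists (push3 c0 (push3 c1 s)); first by do 2 apply: push3_red.
    by rewrite !ev_push3 mulgA involM invg1 mulg1.
  exists (push3 c1 (push3 c2 s)); first by do 2 apply: push3_red.
  by rewrite !ev_push3 mulgA involM mul1g invgK.
- rewrite innM e; case: (ord2_case i) => ->.
    exists (push3 c1 (push3 c0 s)); first by do 2 apply: push3_red.
    by rewrite !ev_push3 mulgA involM mul1g.
  exists (push3 c2 (push3 c1 s)); first by do 2 apply: push3_red.
  by rewrite !ev_push3 mulgA involM invg1 mulg1.
Qed.

Lemma ev_invol_even s : red3 s -> ~~ odd (size s) ->
  exists2 w, ev_word invol s = inn w & tree_word w = s.
Proof.
have [m] := ubnP (size s); elim: m s => // m IH [|x [|y s]] //=.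
  by exists 1; rewrite ?inn1.
rewrite negbK /no_backtrack /= => sz /andP[nxy rs] os.
have [w ew tw] := IH s ltac:(lia) (path_sorted rs) os.
exists (side x * ((side y)^-1 * w)); first by rewrite mulgA involM ew -innM mulgA.
rewrite tree_word_side tree_word_sideV push3K ?push3_red ?tree_word_red // tw.
have -> : push3 y s = y :: s.
  by case: s rs {IH sz os ew tw} => //= z s /andP[/negbTE ->].
by rewrite /= (negbTE nxy).
Qed.

Lemma rho_sigma : rho sigma_F2 = mx2 (-1) 0 0 (-1).
Proof. by rewrite rho_mx2 sigma_u sigma_v !exp_sumE. Qed.

(** An odd word acts by -I on the abelianization. An even word is inner, and
    [tree_word] recovers it from the element of F2. *)
Lemma ev_invol_faithful s : red3 s -> ev_word invol s = 1 -> s = [::].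
Proof.
move=> rs es; have [os|os] := boolP (odd (size s)); last first.
  have [w ew <-] := ev_invol_even rs os; rewrite es in ew.
  by rewrite (inn_eq1 (esym ew)).
have sign s' : rho (ev_word invol s') =
    if odd (size s') then mx2 (-1) 0 0 (-1) else mx2 1 0 0 1.
  elim: s' => [|x s' IH]; first by rewrite -mx2_1; exact: rho1.
  rewrite /= !rhoM rho_inn mul1mx IH rho_sigma.
  by case: odd; rewrite mx2_mul.
by have := sign s; rewrite es os rho1 mx2_1 => /mx2_inj[].
Qed.

(** The automorphism zeta extends to the cyclic permutation a, b, c of the free
    product, since it maps ab to bc and bc to ca. *)
Lemma zeta_invol x : zeta_F2 * invol x = invol (ordS x) * zeta_F2.
Proof.
rewrite /invol mulgA ap_inn -mulgA zeta_sigma !mulgA -innM.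
congr (inn _ * _ * _); case: (ord3P x) => ->.
- by rewrite zeta_u mulgV.
- by rewrite ap1 mul1g.
- by rewrite apV zeta_v invgM !invgK mulgK.
Qed.

Lemma conj_zeta w : (inn w * zeta_F2) ^+ 3 = 1 ->
  conjugate (inn w * zeta_F2) zeta_F2.
Proof.
have [s rs ->] := inn_ev_invol w => s3.
have ordS_inj : injective (@ordS 3) by exact: can_inj (@ordSK 3).
have := @twisted_torsion _ _ id invol zeta_F2 (@ordS 3) 3 (fun=> erefl) _ ordS_inj
  (fun=> erefl) zeta_invol ev_invol_faithful isT zeta3 s rs s3.
case=> [x||[x [h [e _]]]].
- by apply: (@mulgI _ (invol x)); rewrite mulgV invol2.
- by case=> h e; exists h.
- by case: (ord3P x) e => ->.
Qed.

End ThreeInvolutions.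

(** * Elliptic elements of the modular group *)

Section Orders.
Variable G : groupType.
Implicit Types (x y h : G) (m n : nat).

Lemma has_order_uniq x m n : has_order x m -> has_order x n -> m = n.
Proof.
move=> [m0 xm hm] [n0 xn hn]; case: (ltngtP m n) => // letter_elt.
  by case: (hn m); rewrite ?m0.
by case: (hm n); rewrite ?n0.
Qed.

Lemma has_orderJ x h n : has_order x n -> has_order (x ^ h) n.
Proof.
case=> n0 xn hn; split=> // [|m lm]; first by rewrite -conjXg xn conj1g.
by rewrite -conjXg => /eqP; rewrite conjg_eq1 => /eqP; exact: hn.
Qed.

Lemma has_orderV x n : has_order x n -> has_order x^-1 n.
Proof.
case=> n0 xn hn; split=> // [|m lm]; first by rewrite expVgn xn invg1.
by rewrite expVgn => /eqP; rewrite invg_eq1 => /eqP; exact: hn.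
Qed.

Lemma conjugate_sym x y : conjugate x y -> conjugate y x.
Proof. by case=> h ->; exists h^-1; rewrite conjgK. Qed.

End Orders.

Section SL2.
Implicit Types (g h : SL2Z) (a b c d : int).

Lemma SL2_mx g : exists a b c d, SL2_val g = mx2 a b c d /\ (a * d - b * c = 1)%R.
Proof.
exists (g ord0 ord0), (g ord0 ord_max), (g ord_max ord0), (g ord_max ord_max).
split; first exact: mx2_eta.
by rewrite -det_mx2 -mx2_eta; case: g => A /= /eqP.
Qed.

Lemma SL2_valM g h : SL2_val (g * h) = (SL2_val g *m SL2_val h)%R.
Proof. by []. Qed.

(** Determines a conjugate from a product identity, without computing an
    inverse. *)
Lemma SL2_conj g h (X : 'M[int]_2) :
  (SL2_val h *m X = SL2_val g *m SL2_val h)%R -> SL2_val (g ^ h) = X.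
Proof.
move=> e; rewrite conjgE !SL2_valM -e.
have -> : (SL2_val h^-1%g *m (SL2_val h *m X) = X)%R by exact: mulKmx (SL2_unitmx h) X.
by [].
Qed.

Lemma SL2_inv_mx g a b c d : SL2_val g = mx2 a b c d ->
  SL2_val g^-1 = mx2 d (- b) (- c) a.
Proof.
move=> e; have dt : (a * d - b * c = 1)%R.
  by rewrite -det_mx2 -e; case: g {e} => A /= /eqP.
have H : (mx2 d (- b) (- c) a *m SL2_val g = 1%:M)%R.
  rewrite e mx2_mul mx2_1; congr mx2; rewrite ?mulNr; move: dt; nia.
have dX : (\det (mx2 d (- b) (- c) a) == 1)%R by rewrite det_mx2; apply/eqP; lia.
suff -> : g^-1 = SL2 dX by [].
by apply: mulg1_eq; apply: (@mulgI _ (SL2 dX));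
  rewrite mulgA mulg1 (_ : SL2 dX * g = 1) ?mul1g //; apply: val_inj.
Qed.

(** By Cayley-Hamilton the powers of g are p g + q, the pair (p, q) becoming (p
    t + q, - p) at each step, where t is the trace. If |t| >= 2, the inequality
    |p| > |q| propagates from (1, 0), so p is never 0 and a power of g equal to
    1 makes g scalar. *)
Lemma torsion_trace g a b c d : torsion g -> SL2_val g = mx2 a b c d ->
  [\/ (-1 <= a + d <= 1)%R, g = 1 | g = SL2_negI].
Proof.
move=> [[//|n] _ gn] e.
have dt : (a * d - b * c = 1)%R.
  by rewrite -det_mx2 -e; case: (g) {e gn} => A /= /eqP.
have [tr|tr] : (-1 <= a + d <= 1)%R \/ ((2 <= a + d) \/ (a + d <= -2))%R by lia.
  exact: Or31.
have pow k : exists p q : int,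
    SL2_val (g ^+ k.+1) = mx2 (p * a + q) (p * b) (p * c) (p * d + q) /\
    ((0 < p /\ - p < q < p) \/ (p < 0 /\ p < q < - p))%R.
  elim: k => [|k [p [q [ek pq]]]].
    by exists 1%R, 0%R; rewrite expg1 e !mul1r !addr0; split => //; left.
  exists (p * (a + d) + q)%R, (- p)%R; split.
    by rewrite expgSr SL2_valM ek e mx2_mul; congr mx2; nia.
  by case: pq tr => -[p0 /andP[q1 q2]] [t2|t2]; nia.
have [p [q [en pq]]] := pow n.
move: en; rewrite gn => /esym; rewrite [RHS]mx2_1 => /mx2_inj[e1 e2 e3 e4].
have b0 : b = 0%R by nia.
have c0 : c = 0%R by nia.
have ad : a = d by nia.
subst b c d; have [a1|a1] : a = 1%R \/ a = (-1)%R by nia.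
  by apply: Or32; apply: val_inj; rewrite /= e a1 -mx2_1.
apply: Or33; apply: val_inj; rewrite /= e a1 mx2_1.
by apply/matrixP => i j; rewrite !mxE; case: (ord2_case i) => ->; case: (ord2_case j) => ->.
Qed.

Fact abel_subproof (f : aut_plus) : (\det (rho f) == 1)%R.
Proof. by case: f. Qed.
Definition abel (f : aut_plus) : SL2Z := SL2 (abel_subproof f).

Lemma abelM : {morph abel : f f' / f * f'}.
Proof. by move=> f f'; apply: val_inj; rewrite /= rhoM. Qed.
Lemma abel1 : abel 1 = 1.
Proof. by apply: val_inj; rewrite /= rho1. Qed.
Lemma abelV (f : aut_plus) : abel f^-1 = (abel f)^-1.
Proof. by apply: (@mulgI _ (abel f)); rewrite -abelM !mulgV abel1. Qed.
Lemma abelX (f : aut_plus) n : abel (f ^+ n) = abel f ^+ n.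
Proof. by elim: n => [|n IH]; rewrite ?abel1 // !expgS abelM IH. Qed.
Lemma abelJ (f h : aut_plus) : abel (f ^ h) = abel f ^ abel h.
Proof. by rewrite !conjgE !abelM abelV. Qed.

Lemma lift_ofE g (f : aut_plus) : lift_of g f <-> abel f = g.
Proof. by split=> [e|<-]; first exact: val_inj. Qed.

Lemma abel_iota : abel iota_F2 = SL2_S.
Proof. by apply: val_inj; rewrite /= rho_iota. Qed.
Lemma val_M2 : SL2_val (SL2_M ^+ 2) = mx2 0 (-1) 1 (-1).
Proof. by rewrite expg2 SL2_valM mx2_mul. Qed.
Lemma abel_zeta : abel zeta_F2 = SL2_M ^+ 2.
Proof. by apply: val_inj; rewrite /= rho_zeta [RHS]val_M2. Qed.
Lemma val_negI : SL2_val SL2_negI = mx2 (-1) 0 0 (-1).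
Proof.
by apply/matrixP => i j; rewrite !mxE; case: (ord2_case i) => ->; case: (ord2_case j) => ->.
Qed.
Lemma abel_sigma : abel sigma_F2 = SL2_negI.
Proof. by apply: val_inj; rewrite /= rho_sigma [RHS]val_negI. Qed.

Lemma same_abel (f f' : aut_plus) : abel f = abel f' -> exists w, f = inn w * f'.
Proof.
move=> e; have [|w ew] := @ker_rho (f * f'^-1).
  by have /(congr1 SL2_val) : abel (f * f'^-1) = 1 by rewrite abelM abelV e mulgV.
by exists w; rewrite -ew mulgVK.
Qed.

Definition elliptic_reps : seq SL2Z :=
  [:: SL2_M; SL2_M^-1; SL2_S; SL2_S^-1; SL2_M ^+ 2; SL2_M ^- 2].

Lemma rho_upperV : rho upper^-1 = mx2 1 (-1) 0 1.
Proof.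
by have := SL2_inv_mx (g := abel upper) rho_upper; rewrite -abelV oppr0.
Qed.
Lemma rho_lowerV : rho lower^-1 = mx2 1 0 (-1) 1.
Proof.
by have := SL2_inv_mx (g := abel lower) rho_lower; rewrite -abelV oppr0.
Qed.

Lemma val_MV : SL2_val SL2_M^-1 = mx2 0 1 (-1) 1.
Proof. by rewrite (@SL2_inv_mx _ 1 (-1) 1 0). Qed.
Lemma val_SV : SL2_val SL2_S^-1 = mx2 0 1 (-1) 0.
Proof. by rewrite (@SL2_inv_mx _ 0 (-1) 1 0). Qed.
Lemma val_M2V : SL2_val (SL2_M ^- 2) = mx2 (-1) 1 (-1) 0.
Proof. by rewrite (SL2_inv_mx val_M2). Qed.

(** Put m = a - d and t = a + d; then 4 b c = t^2 - 4 - m^2 < 0. If |m| > |c|,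
    conjugation by the upper unipotent or its inverse makes |b| smaller and
    keeps c; symmetrically for |m| > |b| and the lower one. Otherwise m^2 <= - b
    c, which forces b c = -1 and a d = 0. Conjugating only by images of
    automorphisms lets the result be lifted. *)
Lemma elliptic_conj g a b c d : SL2_val g = mx2 a b c d ->
  (-1 <= a + d <= 1)%R -> exists f, g ^ abel f \in elliptic_reps.
Proof.
have [n] := ubnP (`|b| + `|c|)%N; elim: n g a b c d => // n IH g a b c d sz e tr.
have dt : (a * d - b * c = 1)%R.
  by rewrite -det_mx2 -e; case: (g) {e} => A /= /eqP.
have via (f : aut_plus) a' b' c' d' : (rho f *m mx2 a' b' c' d' = mx2 a b c d *m rho f)%R ->
    (`|b'| + `|c'| < `|b| + `|c|)%N -> (a' + d' = a + d)%R ->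
    exists f, g ^ abel f \in elliptic_reps.
  rewrite -e => ef lt_sz tr'.
  have [|||f' ef'] := IH (g ^ abel f) a' b' c' d'.
  - by lia.
  - exact: SL2_conj.
  - by rewrite tr'.
  by exists (f * f'); rewrite abelM conjgM.
(* Applied to the diagonal of any conjugate: it gives b' c' <= -1, so that b'
   and c' keep the signs of b and c. *)
have neg x y : (-1 <= x + y <= 1 -> x * y <= 0 :> int)%R by move=> ?; nia.
have bc : (b * c <= -1)%R by have := neg a d tr; lia.
have c_neq0 : (c < 0 \/ 0 < c)%R by nia.
have [big_c|small_c] : (`|c| < `|a - d| \/ `|a - d| <= `|c|)%R by lia.
  have [up|up] : (0 < (a - d) * c \/ (a - d) * c < 0)%R by nia.
    apply: (via upper (a - c)%R (a - c + b - d)%R c (c + d)%R); last by ring.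
      by rewrite rho_upper !mx2_mul; congr mx2; ring.
    have := neg (a - c)%R (c + d)%R ltac:(lia); case: c_neq0 => c0 ?; nia.
  apply: (via upper^-1 (a + c)%R (b + d - a - c)%R c (d - c)%R); last by ring.
    by rewrite rho_upperV !mx2_mul; congr mx2; ring.
  have := neg (a + c)%R (d - c)%R ltac:(lia); case: c_neq0 => c0 ?; nia.
have [big_b|small_b] : (`|b| < `|a - d| \/ `|a - d| <= `|b|)%R by lia.
  have [up|up] : ((a - d) * b < 0 \/ 0 < (a - d) * b)%R by nia.
    apply: (via lower (a + b)%R b (c - a + d - b)%R (d - b)%R); last by ring.
      by rewrite rho_lower !mx2_mul; congr mx2; ring.
    have := neg (a + b)%R (d - b)%R ltac:(lia); case: c_neq0 => c0 ?; nia.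
  apply: (via lower^-1 (a - b)%R b (c + a - d - b)%R (d + b)%R); last by ring.
    by rewrite rho_lowerV !mx2_mul; congr mx2; ring.
  have := neg (a - b)%R (d + b)%R ltac:(lia); case: c_neq0 => c0 ?; nia.
have fin (f : aut_plus) r X : r \in elliptic_reps -> SL2_val r = X ->
    (rho f *m X = mx2 a b c d *m rho f)%R ->
    exists f, g ^ abel f \in elliptic_reps.
  move=> r_rep <- ef; exists f; suff -> : g ^ abel f = r by [].
  by apply: val_inj; apply: SL2_conj; rewrite e.
have id_comm X : (rho 1%g *m X = X *m rho 1%g)%R by rewrite rho1 mul1mx mulmx1.
have rep i : (i < 6)%N -> nth 1 elliptic_reps i \in elliptic_reps.
  by move=> lt_i; apply: mem_nth.
have prod2 x y : (0 <= x -> 0 <= y -> 0 <= x * y :> int)%R by exact: mulr_ge0.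
have m2 : ((a - d) * (a - d) <= - (b * c))%R.
  case: c_neq0 => c0.
    have b0 : (0 < b)%R by nia.
    have := prod2 (- c - (a - d))%R (b + (a - d))%R ltac:(lia) ltac:(lia).
    have := prod2 (- c + (a - d))%R (b - (a - d))%R ltac:(lia) ltac:(lia).
    by lia.
  have b0 : (b < 0)%R by nia.
  have := prod2 (c - (a - d))%R (- b + (a - d))%R ltac:(lia) ltac:(lia).
  have := prod2 (c + (a - d))%R (- b - (a - d))%R ltac:(lia) ltac:(lia).
  by lia.
have bc_eq : (b * c = -1)%R.
  have := sqr_ge0 (a + d)%R; rewrite expr2.
  by lia.
have bc1 : (c = 1 /\ b = -1 \/ c = -1 /\ b = 1)%R.
  case: c_neq0 => c0.
    have b0 : (0 < b)%R by nia.
    by have := prod2 (b - 1)%R (- c - 1)%R ltac:(lia) ltac:(lia); lia.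
  have b0 : (b < 0)%R by nia.
  by have := prod2 (- b - 1)%R (c - 1)%R ltac:(lia) ltac:(lia); lia.
have ad0 : (a = 0 \/ d = 0)%R by nia.
have [ed|[ed|ed]] : (a + d = 0 \/ a + d = 1 \/ a + d = -1)%R by lia.
- have [? ?] : a = 0%R /\ d = 0%R by lia.
  subst; case: bc1 => -[? ?]; subst.
    exact: (fin 1 _ _ (rep 2 isT) erefl (id_comm _)).
  exact: (fin 1 _ _ (rep 3 isT) val_SV (id_comm _)).
- have [[? ?]|[? ?]] : (a = 1 /\ d = 0 \/ a = 0 /\ d = 1)%R by lia.
    subst; case: bc1 => -[? ?]; subst.
      exact: (fin 1 _ _ (rep 0 isT) erefl (id_comm _)).
    by apply: (fin (upper^-1) _ _ (rep 1%N isT) val_MV); rewrite rho_upperV !mx2_mul.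
  subst; case: bc1 => -[? ?]; subst.
    by apply: (fin (upper^-1) _ _ (rep 0 isT) erefl); rewrite rho_upperV !mx2_mul.
  exact: (fin 1 _ _ (rep 1%N isT) val_MV (id_comm _)).
have [[? ?]|[? ?]] : (a = -1 /\ d = 0 \/ a = 0 /\ d = -1)%R by lia.
  subst; case: bc1 => -[? ?]; subst.
    by apply: (fin (upper^-1) _ _ (rep 4 isT) val_M2); rewrite rho_upperV !mx2_mul.
  exact: (fin 1 _ _ (rep 5 isT) val_M2V (id_comm _)).
subst; case: bc1 => -[? ?]; subst.
  exact: (fin 1 _ _ (rep 4 isT) val_M2 (id_comm _)).
by apply: (fin (upper^-1) _ _ (rep 5 isT) val_M2V); rewrite rho_upperV !mx2_mul.
Qed.

(** If (p, r) is the first column of h, then c' = c p^2 + (d - a) p r - b r^2.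
    This form has negative discriminant (a + d)^2 - 4 and represents c, so it is
    positive definite. *)
Lemma lower_left_sign g h a b c d a' b' c' d' :
  SL2_val g = mx2 a b c d -> SL2_val (g ^ h) = mx2 a' b' c' d' ->
  (-1 <= a + d <= 1 -> 0 < c -> 0 < c')%R.
Proof.
move=> eg egh tr c0.
have [p [q [r [s [eh dh]]]]] := SL2_mx h.
have : (SL2_val h *m SL2_val (g ^ h)%g = SL2_val g *m SL2_val h)%R.
  by rewrite -!SL2_valM conjgE mulVKg.
rewrite eg egh eh !mx2_mul => /mx2_inj[e1 _ e3 _].
have dt : (a * d - b * c = 1)%R.
  by rewrite -det_mx2 -eg; case: (g) {eg egh e1 e3} => A /= /eqP.
have ec : (c' = c * p ^+ 2 + (d - a) * (p * r) - b * r ^+ 2)%R.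
  transitivity (p * (r * a' + s * c') - r * (p * a' + q * c'))%R.
    by transitivity (c' * (p * s - q * r))%R; [rewrite dh mulr1 | ring].
  by rewrite e1 e3; ring.
(* Completing the square in the form. *)
have : (4 * c * c' = (2 * c * p + (d - a) * r) ^+ 2 + (4 - (a + d) ^+ 2) * r ^+ 2)%R.
  rewrite ec.
  have -> : (4 - (a + d) ^+ 2 = 4 * (a * d - b * c) - (a + d) ^+ 2)%R.
    by rewrite dt mulr1.
  by ring.
set u := (2 * c * p + _)%R => E.
have [//|c'0] : (0 < c' \/ c' <= 0)%R by lia.
have t3 : (3 <= 4 - (a + d) ^+ 2)%R.
  by have [->|[->|->]] : (a + d = 0 \/ a + d = 1 \/ a + d = -1)%R by lia.
have cc : (4 * c * c' <= 0)%R by apply: mulr_ge0_le0 => //; lia.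
have [u0 r0] : u = 0%R /\ r = 0%R.
  move: (sqr_ge0 u) (sqr_ge0 r) E cc t3; move: (4 * c * c')%R (4 - _)%R => x k.
  move=> u2 r2 E x0 k3; have kr : (0 <= (k - 3) * r ^+ 2)%R.
    by apply: mulr_ge0 => //; lia.
  by split; apply/eqP; rewrite -sqrf_eq0; apply/eqP; lia.
move: u0; rewrite /u r0 mulr0 addr0 => /eqP.
rewrite mulf_eq0 mulf_eq0 (Order.POrderTheory.gt_eqF c0) /= => /eqP p0.
by move: dh; rewrite p0 r0 mul0r mulr0.
Qed.
End SL2.

(** * Elements of finite order *)

Section Classification.
Implicit Types (g h : SL2Z) (f t : aut_plus).

Lemma val_M3 : SL2_val (SL2_M ^+ 3) = mx2 (-1) 0 0 (-1).
Proof. by rewrite expgS SL2_valM val_M2 mx2_mul. Qed.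

Lemma M3 : SL2_M ^+ 3 = SL2_negI.
Proof. by apply: val_inj; rewrite [LHS]val_M3 [RHS]val_negI. Qed.

Lemma S2 : SL2_S ^+ 2 = SL2_negI.
Proof. by apply: val_inj; rewrite -[LHS]/(SL2_S *m SL2_S)%R mx2_mul [RHS]val_negI. Qed.

Lemma negI2 : SL2_negI ^+ 2 = 1.
Proof.
by apply: val_inj; rewrite expg2 [LHS]SL2_valM val_negI mx2_mul [RHS]mx2_1.
Qed.

Lemma negI_central g : SL2_negI * g = g * SL2_negI.
Proof.
apply: val_inj; rewrite /= !mulNmx mulmxN.
by rewrite mul1mx mulmx1.
Qed.

Lemma SL2_neq1 g a b c d : SL2_val g = mx2 a b c d ->
  (a != 1%R) || (c != 0%R) -> g <> 1.
Proof.
move=> e h g1; move: e; rewrite g1 [LHS]mx2_1 => /mx2_inj[ea _ ec _].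
by move: h; rewrite -ea -ec.
Qed.

Lemma order_negI : has_order SL2_negI 2.
Proof.
split=> // [|[|[|m]] //= _]; first exact: negI2.
by rewrite expg1; apply: (SL2_neq1 val_negI).
Qed.

Lemma order_M : has_order SL2_M 6.
Proof.
have M6 : SL2_M ^+ 6 = 1 by rewrite (expgnA _ 3 2) M3 negI2.
have nM2 : SL2_M ^+ 2 <> 1 by apply: (SL2_neq1 val_M2).
split=> // m; case: m => [|[|[|[|[|[|m]]]]]] // _ e.
- by apply: nM2; rewrite expg2; rewrite expg1 in e; rewrite e mulg1.
- by apply: (SL2_neq1 val_M3).
- by apply: nM2; rewrite -M6 (expgnDr _ 4 2) e mul1g.
- apply: nM2; have M1 : SL2_M = 1 by rewrite -M6 expgSr e mul1g.
  by rewrite M1 expg1n.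
Qed.

Lemma order_S : has_order SL2_S 4.
Proof.
have S4 : SL2_S ^+ 4 = 1 by rewrite (expgnA _ 2 2) S2 negI2.
have nS2 : SL2_S ^+ 2 <> 1 by rewrite S2; apply: (SL2_neq1 val_negI).
split=> // m; case: m => [|[|[|[|m]]]] // _ e; apply: nS2 => //.
- by rewrite expg2; rewrite expg1 in e; rewrite e mulg1.
- have S1 : SL2_S = 1 by rewrite -S4 expgSr e mul1g.
  by rewrite S1 expg1n.
Qed.

Lemma order_M2 : has_order (SL2_M ^+ 2) 3.
Proof.
have [_ M6 hM] := order_M; split=> // [|m lm]; rewrite -expgnA //.
by apply: hM; lia.
Qed.

Lemma torsion_conj g : torsion g ->
  [\/ g = 1, g = SL2_negI | exists f, g ^ abel f \in elliptic_reps].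
Proof.
move=> tg; have [a [b [c [d [e _]]]]] := SL2_mx g.
have [tr|->|->] := torsion_trace tg e; [|exact: Or31|exact: Or32].
by apply: Or33; exact: elliptic_conj e tr.
Qed.

Lemma order_torsion (G : groupType) (x : G) n : has_order x n -> torsion x.
Proof. by case=> n0 xn _; exists n. Qed.

Lemma elliptic_order g f : g ^ abel f \in elliptic_reps ->
  [\/ has_order g 6 /\ (g ^ abel f = SL2_M \/ g ^ abel f = SL2_M^-1),
      has_order g 4 /\ (g ^ abel f = SL2_S \/ g ^ abel f = SL2_S^-1)
    | has_order g 3 /\ (g ^ abel f = SL2_M ^+ 2 \/ g ^ abel f = SL2_M ^- 2)].
Proof.
(* Orders are read off on the representative. *)
have back x n : g ^ abel f = x -> has_order x n -> has_order g n.
  by move=> e /(has_orderJ (abel f)^-1); rewrite -e conjgK.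
rewrite !inE => /or4P[/eqP e|/eqP e|/eqP e|/or3P[/eqP e|/eqP e|/eqP e]].
- by apply: Or31; split; [exact: back e order_M | left].
- by apply: Or31; split; [exact: back e (has_orderV order_M) | right].
- by apply: Or32; split; [exact: back e order_S | left].
- by apply: Or32; split; [exact: back e (has_orderV order_S) | right].
- by apply: Or33; split; [exact: back e order_M2 | left].
- by apply: Or33; split; [exact: back e (has_orderV order_M2) | right].
Qed.

Lemma order1 : has_order (1 : SL2Z) 1.
Proof. by split=> // m; case: m. Qed.

Lemma order2_conj g : has_order g 2 -> g = SL2_negI.
Proof.
move=> g2; have [g1|//|[f /elliptic_order]] := torsion_conj (order_torsion g2).
  by rewrite g1 in g2; have := has_order_uniq order1 g2.
by case=> -[/(has_order_uniq g2)].
Qed.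

Lemma order_elliptic g n : has_order g n -> (2 < n)%N ->
  exists f, g ^ abel f \in elliptic_reps.
Proof.
move=> gn n2; have [g1|g1|//] := torsion_conj (order_torsion gn).
  by rewrite g1 in gn; rewrite (has_order_uniq gn order1) in n2.
by rewrite g1 in gn; rewrite (has_order_uniq gn order_negI) in n2.
Qed.

Lemma order6_conj g : has_order g 6 ->
  exists f, g ^ abel f = SL2_M \/ g ^ abel f = SL2_M^-1.
Proof.
move=> gn; have [f /elliptic_order] := order_elliptic gn isT.
by case=> -[/(has_order_uniq gn) // _ h]; exists f.
Qed.

Lemma order4_conj g : has_order g 4 ->
  exists f, g ^ abel f = SL2_S \/ g ^ abel f = SL2_S^-1.
Proof.
move=> gn; have [f /elliptic_order] := order_elliptic gn isT.
by case=> -[/(has_order_uniq gn) // _ h]; exists f.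
Qed.

Lemma order3_conj g : has_order g 3 ->
  exists f, g ^ abel f = SL2_M ^+ 2 \/ g ^ abel f = SL2_M ^- 2.
Proof.
move=> gn; have [f /elliptic_order] := order_elliptic gn isT.
by case=> -[/(has_order_uniq gn) // _ h]; exists f.
Qed.

Lemma torsion_order g : torsion g -> g <> 1 ->
  exists2 n : nat, n \in [:: 6; 4; 3; 2]%N & has_order g n.
Proof.
move=> tg g1; have [//|->|[f /elliptic_order]] := torsion_conj tg.
  by exists 2%N => //; exact: order_negI.
by case=> -[gn _]; [exists 6%N | exists 4%N | exists 3%N].
Qed.

Lemma order_class_pair n x a b c d : has_order x n ->
  SL2_val x = mx2 a b c d -> (-1 <= a + d <= 1)%R -> (0 < c)%R ->
  (forall g, has_order g n -> exists f, g ^ abel f = x \/ g ^ abel f = x^-1) ->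
  order_class_reps n [:: x; x^-1].
Proof.
move=> xn ex tr c0 classify.
have not_conj : ~ conjugate x x^-1.
  case=> h eh; have e' := SL2_inv_mx ex; rewrite eh in e'.
  by have := lower_left_sign ex e' tr c0; lia.
split=> [y|g /classify[f gf]|y z|].
- by rewrite !inE => /orP[/eqP -> //|/eqP ->]; exact: has_orderV.
- by exists (g ^ abel f); [rewrite !inE; case: gf => ->; rewrite eqxx ?orbT | exists (abel f)].
- rewrite !inE => /orP[/eqP ->|/eqP ->] /orP[/eqP ->|/eqP ->] // c1; case: not_conj => //.
  exact: conjugate_sym.
- rewrite /= inE andbT; apply/negP => /eqP e; apply: not_conj; exists 1.
  by rewrite conjg1 -e.
Qed.

(** Some conjugate of f has the matrix of t or of its inverse; by [same_abel] it
    or its inverse is then inn(w) t. *)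
Lemma conj_standard n t f : (forall w, (inn w * t) ^+ n = 1 -> conjugate (inn w * t) t) ->
  f ^+ n = 1 -> (exists h : aut_plus, abel f ^ abel h = abel t \/ abel f ^ abel h = (abel t)^-1) ->
  conjugate f t \/ conjugate f t^-1.
Proof.
move=> std fn [h []]; rewrite -abelJ -?abelV => /same_abel[w ew]; [left|right].
  have [|k ek] := std w; first by rewrite -ew -conjXg fn conj1g.
  by exists (h * k); rewrite conjgM ew.
have [w' ew'] : exists w', (f ^ h)^-1 = inn w' * t.
  by apply: same_abel; rewrite ew abelV abelM [abel (inn _)](_ : _ = 1)
    ?mul1g ?abelV ?invgK //; apply: val_inj; rewrite /= rho_inn.
have [|k ek] := std w'; first by rewrite -ew' expVgn -conjXg fn conj1g invg1.
by exists (h * k); rewrite conjgM -[f ^ h]invgK ew' conjVg -ek.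
Qed.

Lemma abel_torsion_free f n : abel f = 1 -> (0 < n)%N -> f ^+ n = 1 -> f = 1.
Proof.
rewrite -abel1 => /same_abel[w]; rewrite mulg1 => ->; exact: inn_torsion_free.
Qed.

(** Commutation amounts to zeta(w) v^-1 = w. If w has exponent sums p and q,
    this reads - q = p and p - q - 1 = q, so 3 p = 1. *)
Lemma not_comm_zeta w : zeta_F2 * (inn w * sigma_F2) <> inn w * sigma_F2 * zeta_F2.
Proof.
rewrite mulgA ap_inn -mulgA zeta_sigma !mulgA -innM => /mulIg/mulIg e.
have ew : zeta_F2 w * gen_v^-1 = w.
  apply: divg1_eq; apply: inn_eq1; by rewrite innM innV e mulgV.
have z0 := exp_sum_autom zeta_F2 ord0 w; have z1 := exp_sum_autom zeta_F2 ord_max w.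
have e0 := congr1 (exp_sum ord0) ew; have e1 := congr1 (exp_sum ord_max) ew.
move: z0 z1 e0 e1; rewrite !exp_sumE rho_zeta !big_ord_recl !big_ord0 !mxE /=.
rewrite (_ : lift ord0 ord0 = ord_max); last exact: val_inj.
lia.
Qed.

(** Inner automorphisms are torsion free, so the matrix of f has order 6 as
    well, and some conjugate of f or of its inverse, called d, lies over M. Then
    d^2 lies over M^2 and is conjugate to zeta, while d^3 lies over M^3 = - I.
    *)
Lemma no_order_6 f : has_order f 6 -> False.
Proof.
move=> [_ f6 hf].
have g6 : abel f ^+ 6 = 1 by rewrite -abelX f6 abel1.
have ng2 : abel f ^+ 2 <> 1.
  rewrite -abelX => /(@abel_torsion_free _ 3) g2.
  by apply: (hf 2) => //; apply: g2; rewrite // -expgnA.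
have ng3 : abel f ^+ 3 <> 1.
  rewrite -abelX => /(@abel_torsion_free _ 2) g3.
  by apply: (hf 3) => //; apply: g3; rewrite // -expgnA.
have g_order : has_order (abel f) 6.
  split=> // m; case: m => [|[|[|[|[|[|m]]]]]] // _ e.
  - by apply: ng2; rewrite expg2; rewrite expg1 in e; rewrite e mulg1.
  - by apply: ng2; rewrite -g6 (expgnDr _ 4 2) e mul1g.
  - apply: ng2; have g1 : abel f = 1 by rewrite -g6 expgSr e mul1g.
    by rewrite g1 expg1n.
have [d d6 ed] : exists2 d : aut_plus, d ^+ 6 = 1 & abel d = SL2_M.
  have [h [eh|eh]] := order6_conj g_order.
    by exists (f ^ h); rewrite ?abelJ // -conjXg f6 conj1g.
  exists (f ^ h)^-1; first by rewrite expVgn -conjXg f6 conj1g invg1.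
  by rewrite abelV abelJ eh invgK.
have [k ek] : conjugate (d ^+ 2) zeta_F2.
  have [w ew] := @same_abel (d ^+ 2) zeta_F2 ltac:(by rewrite abelX ed abel_zeta).
  by rewrite ew; apply: conj_zeta; rewrite -ew -expgnA.
have [w ew] : exists w, (d ^ k) ^+ 3 = inn w * sigma_F2.
  apply: same_abel; rewrite abelX abelJ ed abel_sigma -conjXg M3 conjgE.
  by rewrite negI_central mulKg.
apply: (@not_comm_zeta w); rewrite -ew ek conjXg.
by rewrite -!expgnDr.
Qed.

End Classification.

Theorem mainTheorem10 :
  [/\ forall g : SL2Z, torsion g -> g <> 1 ->
        exists2 n : nat, n \in [:: 6; 4; 3; 2]%N & has_order g n,
      order_class_reps 2 [:: SL2_negI],
      order_class_reps 6 [:: SL2_M; SL2_M^-1],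
      order_class_reps 4 [:: SL2_S; SL2_S^-1]
    & order_class_reps 3 [:: SL2_M ^+ 2; SL2_M ^- 2]] /\
  [/\ SL2_val SL2_M = mx2 1 (-1) 1 0,
      SL2_val SL2_M^-1 = mx2 0 1 (-1) 1,
      SL2_val SL2_S = mx2 0 (-1) 1 0,
      SL2_val (SL2_M ^+ 2) = mx2 0 (-1) 1 (-1)
    & SL2_val (SL2_M ^- 2) = mx2 (-1) 1 (-1) 0] /\
  (forall (g : SL2Z) (gamma : aut_plus), lift_of g gamma ->
     [/\ has_order g 2 -> has_order gamma 2 -> conjugate gamma sigma_F2,
         has_order g 4 -> has_order gamma 4 ->
           conjugate gamma iota_F2 \/ conjugate gamma iota_F2^-1
       & has_order g 3 -> has_order gamma 3 ->
           conjugate gamma zeta_F2 \/ conjugate gamma zeta_F2^-1]) /\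
  ~ (exists gamma : aut_plus, has_order gamma 6).
Proof.
split; first split.
- exact: torsion_order.
- split=> [y|g g2|y z|//].
  + by rewrite inE => /eqP ->; exact: order_negI.
  + exists SL2_negI; first by rewrite inE.
    by rewrite (order2_conj g2); exists 1; rewrite conjg1.
  + by rewrite !inE => /eqP -> /eqP ->.
- by apply: (order_class_pair order_M erefl) => // g; exact: order6_conj.
- by apply: (order_class_pair order_S erefl) => // g; exact: order4_conj.
- by apply: (order_class_pair order_M2 val_M2) => // g; exact: order3_conj.
split; first by split=> //; [exact: val_MV | exact: val_M2 | exact: val_M2V].
split=> [g f /lift_ofE <- {g}|[f]]; last exact: no_order_6.
split=> g_order [_ fn _].
- have [|w ew] := @same_abel f sigma_F2.
    by rewrite abel_sigma; exact: order2_conj.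
  by rewrite ew; apply: conj_sigma; rewrite -ew.
- apply: (conj_standard conj_iota fn); rewrite abel_iota; exact: order4_conj.
- apply: (conj_standard conj_zeta fn); rewrite abel_zeta; exact: order3_conj.
Qed.
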